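(* Suppose $\pi(a|s)\le C\mu^b(s)b(a|s)$ for all $s,a$ and some $C>0$, and Assumptions (B1)–(B3) hold. Let $\theta_{t+1}=\mathbf P_{\mathcal C}(\theta_t-\eta_t\hat g_t(\theta_t,z_t))$, $\theta_0\in\mathcal C$, $\bar\theta_T$ the average of the iterates. (a) For direct-SGD or TD-SGD with $\eta_t=\eta_0t^{-1/2}$: $\mathbb E\,l(\bar\theta_T)-l(\theta^* )=O(\log T/\sqrt T)$. (b) If $l$ is strongly convex, then for direct-SGD or TD-SGD with step sizes $\eta_1\in[1/c,2/c]$, $\eta_{t+1}=\exp(-\tfrac12c\eta_t)\eta_t$ (with $c>0$ a lower bound on the strong convexity constant), $\mathbb E\|\bar\theta_T-\theta^*\|^2=O((\log T)^3/T)$ and $\mathbb E\,l(\bar\theta_T)-l(\theta^* )=O((\log T)^3/T)$. (c) If, for TD(0), the averaged direction $\bar g(\theta)=-\sum_s\delta(\theta,s)(\varphi(s)+\zeta)$ is a $c$-contraction towards $\theta^*$, then TD(0) with the step sizes of (b) satisfies the same rates as in (b).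
   Context: Setting. $\mathcal S$ finite state space, $\mathcal A$ finite action space; $P(\cdot|s,a)$ next-state distributions and $P(r|s,a)$ finitely supported reward distributions, independent given $(s,a)$; $\gamma\in(0,1]$. Policies $\pi$ (target) and $b$ (behavior) are families of distributions on $\mathcal A$; $P^\pi(s,s')=\sum_a\pi(a|s)P(s'|s,a)$; $\mu^b$ is the stationary distribution of $P^b$. Features $\varphi:\mathcal S\to\mathbb R^d$, $\zeta\in\mathbb R^d$ with $\zeta=0$ if $\gamma<1$ and $\zeta^T\varphi(s)=0$ for all $s$ if $\gamma=1$. $\xi^\pi(s)=\sum_a\sum_r\pi(a|s)P(r|s,a)r$, $\phi^\pi(s)=\sum_a\sum_{s'}\pi(a|s)P(s'|s,a)\varphi(s')$, $\delta(\theta,s)=\xi^\pi(s)+(-\zeta+\gamma\phi^\pi(s)-\varphi(s))^T\theta$, $l(\theta)=\sum_s\mu^b(s)\frac12\delta(\theta,s)^2$; $\theta^*$ satisfies $\delta(\theta^*,s)=0$ for all $s$. Data: $z_t=(s_t,a_t,r_t,s_{t+1})$ generated by running the MDP under $b$ ($a_t\sim b(\cdot|s_t)$, $r_t\sim P(\cdot|s_t,a_t)$, $s_{t+1}\sim P(\cdot|s_t,a_t)$). Update directions for $z=(s,a,r,s')$: direct-SGD $g(\theta,z)=\delta(\theta,s)(-\zeta+\gamma\phi^\pi(s)-\varphi(s))$; TD-SGD $g(\theta,z)=\frac{\pi(a|s)}{b(a|s)}\delta(\theta,s)(-\zeta+\gamma\varphi(s')-\varphi(s))$; TD(0) $g(\theta,z)=-\frac1{\mu^b(s)}\frac{\pi(a|s)}{b(a|s)}(r-\zeta^T\theta+\gamma\varphi(s')^T\theta-\varphi(s)^T\theta)(\varphi(s)+\zeta)$.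 The approximations $\hat g_t$ are obtained by replacing, in direct-SGD and TD-SGD, $\xi^\pi(s)$ and $\phi^\pi(s)$ by $\sum_r r\,\hat p_t(r|s)$ and $\sum_{s'}\hat p_t(s'|s)\varphi(s')$, where $\hat p_t(\cdot|s)$ are data-based estimates of $p(s'|s)=\sum_a\pi(a|s)P(s'|s,a)$ and $p(r|s)=\sum_a\pi(a|s)P(r|s,a)$; and, in TD(0), by replacing $\mu^b(s)$ by a data-based estimate $\hat\mu^b_t(s)$. $\mathbf P_{\mathcal C}$ is Euclidean projection onto a closed convex $\mathcal C$. (B1) $\theta^*\in\mathcal C$; there are $\tilde M,\tilde C_0,\tilde C_1>0$ with $|r|<\tilde M$ a.s., $\|\zeta\|_\infty,\|\varphi\|_\infty\le\tilde C_0$, $\mathcal C\subset\{\|\theta\|\le\tilde C_1\}$. (B2) $b$ generates an irreducible ergodic chain on $\mathcal S$ with finite mixing time $\tau$ ($\|P^b(s_\tau\in\cdot|s_0)-\mu^b\|_{TV}\le1/4$ for all $s_0$). (B3) There are random variables $\tilde e_t$ with $\mathbb E\tilde e_t^2=O(1/t)$ such that $\|\hat p_t(\cdot|s_t)-p(\cdot|s_t)\|_\infty\le\tilde e_t$ and $|1/\hat\mu^b_t(s_t)-1/\mu^b(s_t)|\le\tilde e_t$. A vector field $\bar g$ is a $c$-contraction towards $\theta^*$ if $\bar g(\theta^* )=0$ and $\langle\theta-\theta^*,\bar g(\theta)\rangle\ge c\|\theta-\theta^*\|^2$. *)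

(* Defs.v *)
From HB Require Import structures.
From mathcomp Require Import all_boot all_order all_algebra.
From mathcomp Require Import all_classical all_reals all_analysis.
Set Implicit Arguments. Unset Strict Implicit. Unset Printing Implicit Defensive.
Import Order.TTheory GRing.Theory Num.Theory.
Import numFieldNormedType.Exports.
Local Open Scope ring_scope.
Local Open Scope classical_set_scope.

Section Vec.
Context {R : realType} {d : nat}.
Implicit Types u v x y : 'rV[R]_d.

Definition dotv u v : R := \sum_(i < d) u ord0 i * v ord0 i.
Definition sqnormv u : R := dotv u u.
Definition normv u : R := Num.sqrt (sqnormv u).
Definition supnormv u : R := \big[Num.max/0]_(i < d) `|u ord0 i|.

Definition convex_setv (C : set 'rV[R]_d) : Prop :=
  forall x y, C x -> C y -> forall t : R, 0 <= t <= 1 -> C (t *: x + (1 - t) *: y).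

Definition is_eucl_proj (C : set 'rV[R]_d) (p : 'rV[R]_d -> 'rV[R]_d) : Prop :=
  forall x, C (p x) /\ forall y, C y -> sqnormv (x - p x) <= sqnormv (x - y).

Definition strongly_convex (c : R) (f : 'rV[R]_d -> R) : Prop :=
  forall x y (t : R), 0 <= t <= 1 ->
    f (t *: x + (1 - t) *: y) <=
      t * f x + (1 - t) * f y - c / 2 * t * (1 - t) * sqnormv (x - y).

Definition contraction_towards (c : R) (g : 'rV[R]_d -> 'rV[R]_d) (th0 : 'rV[R]_d) : Prop :=
  g th0 = 0 /\ forall th, c * sqnormv (th - th0) <= dotv (th - th0) (g th).
End Vec.

Section MDP.
Context {R : realType} {S A W : finType} {d : nat}.
(* P s a s' = P(s'|s,a); Pr s a w = P(r = rv w | s,a), the rewards take the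
   finitely many values rv w, w : W *)
Variables (P : S -> A -> S -> R) (Pr : S -> A -> W -> R) (rv : W -> R)
  (gamma : R) (pi b : S -> A -> R) (mu : S -> R)
  (phi : S -> 'rV[R]_d) (zeta : 'rV[R]_d).

Definition is_distr {T : finType} (p : T -> R) : Prop :=
  (forall x, 0 <= p x) /\ \sum_x p x = 1.

Definition Pb (s s' : S) : R := \sum_a b s a * P s a s'.
Fixpoint Pbn (n : nat) (s s' : S) : R :=
  match n with
  | 0 => (s == s')%:R
  | n'.+1 => \sum_x Pbn n' s x * Pb x s'
  end.

Definition stationary (m : S -> R) : Prop :=
  is_distr m /\ forall s', \sum_s m s * Pb s s' = m s'.

Definition irreducible : Prop := forall s s', exists n, 0 < Pbn n s s'.

Definition tv (p q : S -> R) : R := 2^-1 * \sum_s `|p s - q s|.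

Definition mixing_time (tau : nat) : Prop :=
  forall s0, tv (Pbn tau s0) mu <= 4^-1.

Definition ppi (s s' : S) : R := \sum_a pi s a * P s a s'.
Definition rpi (s : S) (w : W) : R := \sum_a pi s a * Pr s a w.

Definition xi_of (pr : W -> R) : R := \sum_w pr w * rv w.
Definition phi_of (ps : S -> R) : 'rV[R]_d := \sum_s' ps s' *: phi s'.

Definition xipi (s : S) : R := xi_of (rpi s).
Definition phipi (s : S) : 'rV[R]_d := phi_of (ppi s).

Definition dir_of (ph : 'rV[R]_d) (s : S) : 'rV[R]_d := - zeta + gamma *: ph - phi s.
Definition delta_of (xi : R) (ph : 'rV[R]_d) (th : 'rV[R]_d) (s : S) : R :=
  xi + dotv (dir_of ph s) th.

Definition delta (th : 'rV[R]_d) (s : S) : R := delta_of (xipi s) (phipi s) th s.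
Definition loss (th : 'rV[R]_d) : R := \sum_s mu s * (2^-1 * delta th s ^+ 2).

Definition gbar_td0 (th : 'rV[R]_d) : 'rV[R]_d := - \sum_s delta th s *: (phi s + zeta).

Definition ghat_direct (prh : W -> R) (psh : S -> R) (th : 'rV[R]_d) (s : S) : 'rV[R]_d :=
  delta_of (xi_of prh) (phi_of psh) th s *: dir_of (phi_of psh) s.
Definition ghat_tdsgd (prh : W -> R) (psh : S -> R) (th : 'rV[R]_d)
    (s : S) (a : A) (s' : S) : 'rV[R]_d :=
  (pi s a / b s a * delta_of (xi_of prh) (phi_of psh) th s) *:
    (- zeta + gamma *: phi s' - phi s).
Definition ghat_td0 (muh : R) (th : 'rV[R]_d) (s : S) (a : A) (r : R) (s' : S) : 'rV[R]_d :=
  - ((muh^-1 * (pi s a / b s a)) *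
       (r - dotv zeta th + gamma * dotv (phi s') th - dotv (phi s) th)) *: (phi s + zeta).

Inductive alg := DirectSGD | TDSGD | TD0.

Section Iter.
Variable Omega : Type.
(* z_t = (st t, at_ t, rv (rt t), st t.+1) *)
Variables (st : nat -> Omega -> S) (at_ : nat -> Omega -> A) (rt : nat -> Omega -> W).
(* estimates: phat t w s s' = hat p_t(s'|s), rhat t w s w' = hat p_t(rv w'|s),
   muhat t w s = hat mu^b_t(s) *)
Variables (phat : nat -> Omega -> S -> S -> R) (rhat : nat -> Omega -> S -> W -> R)
  (muhat : nat -> Omega -> S -> R).

Definition ghat (al : alg) (t : nat) (th : 'rV[R]_d) (om : Omega) : 'rV[R]_d :=
  let s := st t om in let a := at_ t om in let s' := st t.+1 om in
  match al with
  | DirectSGD => ghat_direct (rhat t om s) (phat t om s) th s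
  | TDSGD => ghat_tdsgd (rhat t om s) (phat t om s) th s a s'
  | TD0 => ghat_td0 (muhat t om s) th s a (rv (rt t om)) s'
  end.

Variables (proj : 'rV[R]_d -> 'rV[R]_d) (eta : nat -> R) (theta_init : 'rV[R]_d).

(* iter al n om = theta_{n+1}; theta_1 = theta_init and
   theta_{t+1} = proj (theta_t - eta_t * hat g_t(theta_t, z_t)) for t >= 1 *)
Fixpoint iter (al : alg) (n : nat) (om : Omega) : 'rV[R]_d :=
  match n with
  | 0 => theta_init
  | n'.+1 => proj (iter al n' om - eta n'.+1 *: ghat al n'.+1 (iter al n' om) om)
  end.

Definition avg_iter (al : alg) (T : nat) (om : Omega) : 'rV[R]_d :=
  T%:R^-1 *: \sum_(n < T) iter al n om.

Definition data_based {X : Type} (t : nat) (f : Omega -> X) : Prop :=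
  forall om om', (forall i, (i <= t)%N ->
      [/\ st i om = st i om', at_ i om = at_ i om', rt i om = rt i om'
        & st i.+1 om = st i.+1 om']) -> f om = f om'.
End Iter.

Definition traj_law {dO : measure_display} {Omega : measurableType dO}
    (Pm : probability Omega R) (nu : S -> R)
    (st : nat -> Omega -> S) (at_ : nat -> Omega -> A) (rt : nat -> Omega -> W) : Prop :=
  forall (n : nat) (xs : nat -> S) (ys : nat -> A) (ws : nat -> W),
    Pm [set om | (forall i, (i < n)%N ->
                    [/\ st i om = xs i, at_ i om = ys i & rt i om = ws i])
                 /\ st n om = xs n]
    = (nu (xs 0%N) * \prod_(i < n)
          (b (xs i) (ys i) * Pr (xs i) (ys i) (ws i) * P (xs i) (ys i) (xs i.+1)))%:E.
End MDP.

(* Main.v *)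
(** The iterates satisfy a projected stochastic approximation recursion whose
    direction is [g + h]: [g] is bounded and has conditional mean
    [Q (theta, s_t) = <dir s_t, x> <v s_t, x>] against [x = theta - thetastar],
    and [|h| = O (e_t + e_t^2)] where [e_t] sums the estimation errors.

    - The estimates take finitely many values up to each time, so every
      expectation is a finite sum over histories.  Since only [E e_t^2 = O(1/t)]
      is known, [E |h|^2] may be infinite; the quadratic part of [h] is absorbed
      by the boundedness of [C].
    - Markovian noise is removed with the Poisson equation for [P^b] (solvable
      by irreducibility alone), which makes it telescope up to terms of the
      order of the step size.
    - This gives [E|x_{t+1}|^2 <= E|x_t|^2 - 2 eta_t (B_t + u_t - u_{t+1}) + ...]
      with [B_t] the mean of [\sum_s mu s * Q (theta_t, s)], and [u_t] bounded.
      In case (a), [B_t = 2 E l(theta_t)] and one sums by parts; in cases (b)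
      and (c), [B_t >= c E|x_t|^2] and the recursion yields [E|x_t|^2 = O(1/t)].
*)
Require Import Defs.
From HB Require Import structures.
From mathcomp Require Import all_boot all_order all_algebra.
From mathcomp Require Import all_classical all_reals all_analysis.
From mathcomp Require Import measurable_realfun.
From mathcomp Require Import ring lra.
Import Order.TTheory GRing.Theory Num.Theory.
Import numFieldNormedType.Exports.
Set Implicit Arguments.
Unset Strict Implicit.
Unset Printing Implicit Defensive.
Local Open Scope ring_scope.
Local Open Scope classical_set_scope.

(** * Euclidean projections *)

Section Euclidean.
Context {R : realType} {d : nat}.
Implicit Types (u v w x y : 'rV[R]_d) (a : R).

(** The estimates used at time [t] may depend on the whole transition [z_t], its action and next
    state included. So [h] has no usable conditional mean and is bounded path by path, while [g],
    built from the exact probabilities, is averaged over the transition. Since [delta] vanishes at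
    [thetastar] in every state, it is linear in [x], and the mean drift has no linear part: this
    puts the three directions under one recursion.

    The cross term [e_t |x_t|] is split with a free weight [kappa]. In case (a), [kappa = sqrt t]
    balances the two halves. In cases (b) and (c), the constant [kappa = 2 K / c] lets the
    contraction absorb one half and still leaves a factor [1 - (3/2) c eta_t]. Since
    [c eta_t >= 1/t] and [3/2 > 1], the squared distance decays like [1/t] without a logarithm;
    averaging the iterates then costs one, through the harmonic sum. The resulting bounds are
    weakened to the stated ones by [ln T >= 1/2]. *)

Lemma dotvC u v : dotv u v = dotv v u.
Proof. by apply: eq_bigr => i _; rewrite mulrC. Qed.

Lemma dotvDl u v w : dotv (u + v) w = dotv u w + dotv v w.
Proof. by rewrite -big_split/=; apply: eq_bigr => i _; rewrite mxE mulrDl. Qed.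

Lemma dotvZl a u v : dotv (a *: u) v = a * dotv u v.
Proof. by rewrite /dotv mulr_sumr; apply: eq_bigr => i _; rewrite mxE mulrA. Qed.

Lemma dotvDr u v w : dotv u (v + w) = dotv u v + dotv u w.
Proof. by rewrite dotvC dotvDl !(dotvC u). Qed.

Lemma dotvZr a u v : dotv u (a *: v) = a * dotv u v.
Proof. by rewrite dotvC dotvZl dotvC. Qed.

Lemma dotvNl u v : dotv (- u) v = - dotv u v.
Proof. by rewrite -scaleN1r dotvZl mulN1r. Qed.

Lemma dotvNr u v : dotv u (- v) = - dotv u v.
Proof. by rewrite dotvC dotvNl dotvC. Qed.

Lemma dotvBl u v w : dotv (u - v) w = dotv u w - dotv v w.
Proof. by rewrite dotvDl dotvNl. Qed.

Lemma dotvBr u v w : dotv u (v - w) = dotv u v - dotv u w.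
Proof. by rewrite dotvDr dotvNr. Qed.

Lemma dotv0l u : dotv 0 u = 0.
Proof. by rewrite -(scale0r u) dotvZl mul0r. Qed.

Lemma dotv_suml (I : Type) (r : seq I) (p : pred I) (F : I -> 'rV[R]_d) u :
  dotv (\sum_(i <- r | p i) F i) u = \sum_(i <- r | p i) dotv (F i) u.
Proof. by apply: (big_morph (dotv^~ u)) => [? ?|]; rewrite ?dotvDl ?dotv0l. Qed.

Lemma sqnormv_ge0 u : 0 <= sqnormv u.
Proof. by apply: sumr_ge0 => i _; rewrite -expr2 sqr_ge0. Qed.

Lemma sqnormvN u : sqnormv (- u) = sqnormv u.
Proof. by rewrite /sqnormv dotvNl dotvNr opprK. Qed.

Lemma sqnormvZ a u : sqnormv (a *: u) = a ^+ 2 * sqnormv u.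
Proof. by rewrite /sqnormv dotvZl dotvZr mulrA. Qed.

Lemma sqnormvD u v : sqnormv (u + v) = sqnormv u + 2 * dotv u v + sqnormv v.
Proof. by rewrite /sqnormv !dotvDl !dotvDr (dotvC v u); ring. Qed.

Lemma sqnormvB u v : sqnormv (u - v) = sqnormv u - 2 * dotv u v + sqnormv v.
Proof. by rewrite sqnormvD sqnormvN dotvNr; ring. Qed.

Lemma normv_ge0 u : 0 <= normv u. Proof. exact: sqrtr_ge0. Qed.

Lemma sqr_normv u : normv u ^+ 2 = sqnormv u.
Proof. by rewrite sqr_sqrtr// sqnormv_ge0. Qed.

Lemma normv0 : normv (0 : 'rV[R]_d) = 0.
Proof. by rewrite /normv /sqnormv dotv0l sqrtr0. Qed.

Lemma normvZ a u : normv (a *: u) = `|a| * normv u.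
Proof. by rewrite /normv sqnormvZ sqrtrM ?sqr_ge0// sqrtr_sqr. Qed.

Lemma normvN u : normv (- u) = normv u.
Proof. by rewrite /normv sqnormvN. Qed.

Lemma cauchy_schwarz u v : `|dotv u v| <= normv u * normv v.
Proof.
rewrite -ler_sqr ?nnegrE ?mulr_ge0 ?normv_ge0// exprMn !sqr_normv real_normK ?num_real//.
have [v0|v0] := eqVneq (sqnormv v) 0.
  have := v0; move/eqP; rewrite psumr_eq0 => [|i _]; last by rewrite -expr2 sqr_ge0.
  move=> /allP v00; rewrite v0 mulr0 /dotv big1 ?expr0n// => i _.
  have /= := v00 i (mem_index_enum i).
  by rewrite -expr2 sqrf_eq0 => /eqP ->; rewrite mulr0.
have vp : 0 < sqnormv v by rewrite lt_def v0 sqnormv_ge0.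
have := sqnormv_ge0 (sqnormv v *: u - dotv u v *: v).
rewrite sqnormvB !sqnormvZ dotvZl dotvZr.
rewrite (_ : _ + _ = sqnormv v * (sqnormv u * sqnormv v - dotv u v ^+ 2)); last by ring.
by rewrite pmulr_rge0// subr_ge0.
Qed.

Lemma dotv_le u v : dotv u v <= normv u * normv v.
Proof. exact: le_trans (ler_norm _) (cauchy_schwarz u v). Qed.

Lemma dotv_ge u v : - (normv u * normv v) <= dotv u v.
Proof. by rewrite lerNl -dotvNl (le_trans (dotv_le _ _))// normvN. Qed.

Lemma normvD u v : normv (u + v) <= normv u + normv v.
Proof.
rewrite -ler_sqr ?nnegrE ?addr_ge0 ?normv_ge0// sqr_normv sqnormvD sqrrD !sqr_normv.
by have := dotv_le u v; lra.
Qed.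

Lemma normvB u v : normv (u - v) <= normv u + normv v.
Proof. by rewrite (le_trans (normvD _ _))// normvN. Qed.

Lemma normv_sum (I : Type) (r : seq I) (p : pred I) (F : I -> 'rV[R]_d) :
  normv (\sum_(i <- r | p i) F i) <= \sum_(i <- r | p i) normv (F i).
Proof.
elim/big_ind2: _ => [|x1 x2 y1 y2 h1 h2|//]; first by rewrite normv0.
by rewrite (le_trans (normvD _ _))// lerD.
Qed.

Lemma sqr_mean_le (n : nat) (y : 'I_n -> R) :
  (n%:R^-1 * \sum_i y i) ^+ 2 <= n%:R^-1 * \sum_i y i ^+ 2.
Proof.
case: n y => [|n] y; first by rewrite !big_ord0 !mulr0 expr0n.
set m := _ * _; have n0 : (0 : R) < n.+1%:R by rewrite ltr0n.
have sy : \sum_i y i = n.+1%:R * m by rewrite mulrA divff ?mul1r ?gt_eqF.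
have : 0 <= \sum_i (y i - m) ^+ 2 by apply: sumr_ge0 => i _; exact: sqr_ge0.
under eq_bigr do rewrite sqrrB.
rewrite big_split/= sumrB sumrMnl -mulr_suml sy.
rewrite sumr_const card_ord -(mulr_natl (m ^+ 2)) => h.
by rewrite ler_pdivlMl//; lra.
Qed.

Lemma sqnormv_mean_le (n : nat) (F : 'I_n -> 'rV[R]_d) :
  sqnormv (n%:R^-1 *: \sum_i F i) <= n%:R^-1 * \sum_i sqnormv (F i).
Proof.
rewrite /sqnormv /dotv exchange_big mulr_sumr /=; apply: ler_sum => j _.
by rewrite mxE summxE -expr2 (le_trans (sqr_mean_le _)).
Qed.

(* Compare [p x] with the points [t *: y + (1 - t) *: p x] as [t] tends to 0. *)
Lemma eucl_proj_obtuse (C : set 'rV[R]_d) p x y : convex_setv C -> is_eucl_proj C p ->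
  C y -> dotv (x - p x) (y - p x) <= 0.
Proof.
move=> Cc Cp Cy; have [Cpx pmin] := Cp x.
set a := x - p x; set w := y - p x.
have key (t : R) : 0 < t -> t <= 1 -> 2 * dotv a w <= t * sqnormv w.
  move=> t0 t1; have t01 : 0 <= t <= 1 by rewrite (ltW t0).
  have := pmin _ (Cc _ _ Cy Cpx t t01).
  have -> : x - (t *: y + (1 - t) *: p x) = a - t *: w.
    rewrite /a /w scalerBl scale1r scalerBr !opprD !opprK.
    by apply/rowP => i; rewrite !mxE; ring.
  rewrite -/a (sqnormvB a (t *: w)) sqnormvZ dotvZr => h.
  rewrite -(ler_pM2l t0); move: h.
  by set A := sqnormv a; set B := sqnormv w; set c := dotv a w; lra.
rewrite leNgt; apply/negP => aw.
have w0 := sqnormv_ge0 w.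
(* The step [t = c / (|w|^2 + c + 1)], with [c = dotv a w > 0], lies in [(0, 1]] and satisfies
   [t |w|^2 < 2 c], against [key]. *)
have s0 : 0 < sqnormv w + dotv a w + 1 by lra.
have h1 : dotv a w / (sqnormv w + dotv a w + 1) <= 1.
  by rewrite ler_pdivrMr// mul1r; lra.
have := key _ (divr_gt0 aw s0) h1.
apply/negP; rewrite -ltNge mulrAC ltr_pdivrMr//.
set B := sqnormv w in w0 *; set c := dotv a w in aw *.
by nra.
Qed.

End Euclidean.

(** * Poisson equation of a finite chain *)

Section FiniteChain.
Context {R : realType} {S A : finType}.
Variables (P : S -> A -> S -> R) (b : S -> A -> R) (mu : S -> R).
Hypothesis HP : forall s a, is_distr (P s a).
Hypothesis Hb : forall s, is_distr (b s).
Hypothesis Hmu : stationary P b mu.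
Hypothesis Hirr : irreducible P b.

Lemma Pb_ge0 s s' : 0 <= Pb P b s s'.
Proof.
by apply: sumr_ge0 => a _; apply: mulr_ge0; [have [] := Hb s|have [] := HP s a].
Qed.

Lemma Pb_sum1 s : \sum_s' Pb P b s s' = 1.
Proof.
rewrite exchange_big/= -[RHS](proj2 (Hb s)); apply: eq_bigr => a _.
by rewrite -mulr_sumr (proj2 (HP s a)) mulr1.
Qed.

Lemma Pbn_ge0 n s s' : 0 <= Pbn P b n s s'.
Proof.
elim: n s' => [|n IH] s' /=; first by rewrite ler0n.
by apply: sumr_ge0 => x _; rewrite mulr_ge0 ?IH ?Pb_ge0.
Qed.

Lemma Pbn_sum1 n s : \sum_s' Pbn P b n s s' = 1.
Proof.
elim: n => [|n IH] /=.
  rewrite (bigD1 s)//= eqxx big1 ?addr0// => x xs.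
  by rewrite eq_sym (negbTE xs).
rewrite exchange_big/= -[RHS]IH; apply: eq_bigr => x _.
by rewrite -mulr_sumr Pb_sum1 mulr1.
Qed.

Lemma stationary_Pbn n s' : \sum_s mu s * Pbn P b n s s' = mu s'.
Proof.
elim: n s' => [|n IH] s' /=.
  rewrite (bigD1 s')//= eqxx mulr1 big1 ?addr0// => x xs.
  by rewrite (negbTE xs) mulr0.
under eq_bigr do rewrite mulr_sumr.
rewrite exchange_big/= -[RHS](proj2 Hmu); apply: eq_bigr => x _.
by rewrite -IH mulr_suml; apply: eq_bigr => s _; rewrite mulrA.
Qed.

(** Some state [x] carries mass because the total is 1; the invariance of [mu] under [Pbn n] moves
    part of it to [s] along a path given by irreducibility. *)
Lemma stationary_gt0 s : 0 < mu s.
Proof.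
have [[mu0 mu1] _] := Hmu.
have [x mux] : exists x, 0 < mu x.
  apply/existsP; rewrite -[X in is_true X]negbK negb_exists; apply/negP => /forallP h.
  have : \sum_x mu x = 0.
    by apply: big1 => x _; apply/eqP; rewrite eq_le mu0 andbT leNgt h.
  by rewrite mu1 => /eqP; rewrite oner_eq0.
have [n Pn] := Hirr x s; rewrite -(stationary_Pbn n) (bigD1 x)//=.
rewrite ltr_wpDr ?mulr_gt0//; apply: sumr_ge0 => y _.
by rewrite mulr_ge0 ?mu0 ?Pbn_ge0.
Qed.

Definition harmonic (v : S -> R) := forall s, \sum_s' Pb P b s s' * v s' = v s.

Lemma harmonic_Pbn v n s : harmonic v -> \sum_s' Pbn P b n s s' * v s' = v s.
Proof.
move=> hv; elim: n => [|n IH] /=.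
  rewrite (bigD1 s)//= eqxx mul1r big1 ?addr0// => x xs.
  by rewrite eq_sym (negbTE xs) mul0r.
under eq_bigr do rewrite mulr_suml.
rewrite exchange_big/= -[RHS]IH; apply: eq_bigr => x _.
by rewrite -(hv x) mulr_sumr; apply: eq_bigr => s' _; rewrite mulrA.
Qed.

(* Maximum principle: irreducibility propagates the maximum to every state. *)
Lemma harmonic_cst v s s' : harmonic v -> v s = v s'.
Proof.
move=> hv; pose m := [arg max_(x > s) v x]%O.
suff all_m x : v x = v m by rewrite !all_m.
have mP y : v y <= v m by rewrite /m; case: arg_maxP => //= i _ /(_ y isT).
have [n Pn] := Hirr m x.
have : \sum_y Pbn P b n m y * (v m - v y) = 0.
  under eq_bigr do rewrite mulrBr.
  by rewrite sumrB -mulr_suml Pbn_sum1 mul1r harmonic_Pbn// subrr.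
move/eqP; rewrite psumr_eq0 => [/allP/(_ x (mem_index_enum x))/=|y _].
  by rewrite mulf_eq0 (gt_eqF Pn)/= subr_eq0 => /eqP.
by rewrite mulr_ge0 ?Pbn_ge0// subr_ge0.
Qed.

(* The fundamental matrix [I - P + 1 mu] is injective, hence invertible, and
   stationarity shows that its inverse solves the Poisson equation. *)
Lemma poisson_equation (f : S -> R) : \sum_s mu s * f s = 0 ->
  exists q : S -> R, forall s, q s - \sum_s' Pb P b s s' * q s' = f s.
Proof.
move=> muf; have [[mu0 mu1] muP] := Hmu.
pose Z (q : S -> R) s := q s - \sum_s' Pb P b s s' * q s' + \sum_x mu x * q x.
have muZ q : \sum_s mu s * Z q s = \sum_x mu x * q x.
  rewrite /Z; under eq_bigr do rewrite mulrDr mulrBr.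
  rewrite big_split sumrB/= -mulr_suml mu1 mul1r.
  rewrite [X in _ - X](_ : _ = \sum_x mu x * q x) ?subrr ?add0r//.
  under eq_bigr do rewrite mulr_sumr.
  rewrite exchange_big/=; apply: eq_bigr => x _.
  by rewrite -(muP x) mulr_suml; apply: eq_bigr => s _; rewrite mulrA.
(* By [muZ], a solution of [Z q = f] satisfies [mu q = mu f = 0], so the rank-one term of [Z]
   disappears. *)
suff [q qf] : exists q, forall s, Z q s = f s.
  have muq : \sum_x mu x * q x = 0.
    by rewrite -muZ -[RHS]muf; apply: eq_bigr => x _; rewrite qf.
  by exists q => s; rewrite -(qf s) /Z muq addr0.
have Z_inj q : (forall s, Z q s = 0) -> forall s, q s = 0.
  move=> Zq; have muq : \sum_x mu x * q x = 0.
    by rewrite -muZ big1// => s _; rewrite Zq mulr0.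
  have hq : harmonic q.
    by move=> s; apply/esym/eqP; rewrite -subr_eq0; have := Zq s; rewrite /Z muq addr0 => ->.
  move=> s; rewrite -muq (eq_bigr (fun x => mu x * q s)) => [|x _].
    by rewrite -mulr_suml mu1 mul1r.
  by rewrite (harmonic_cst x s hq).
pose ev (u : 'rV[R]_#|S|) s := u ord0 (enum_rank s).
(* Row [j] of [M] is the image under [Z] of the indicator of state [j], so [Z] acts on row vectors
   by right multiplication and its injectivity says that the row kernel of [M] is zero. *)
pose M : 'M[R]_#|S| := \matrix_(j, i) Z (fun s => (enum_rank s == j)%:R) (enum_val i).
have MZ u s : (u *m M) ord0 (enum_rank s) = Z (ev u) s.
  rewrite !mxE; under eq_bigr do rewrite mxE enum_rankK.
  have dec (x : S) : ev u x = \sum_j u ord0 j * (enum_rank x == j)%:R.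
    rewrite (bigD1 (enum_rank x))//= eqxx mulr1 big1 ?addr0// => j jx.
    by rewrite eq_sym (negbTE jx) mulr0.
  have lin (c : S -> R) :
      \sum_x c x * ev u x = \sum_j u ord0 j * \sum_x c x * (enum_rank x == j)%:R.
    under eq_bigr do rewrite dec mulr_sumr.
    rewrite exchange_big/=; apply: eq_bigr => j _; rewrite mulr_sumr.
    by apply: eq_bigr => x _; rewrite mulrCA.
  by rewrite /Z dec !lin -sumrB -big_split/=; apply: eq_bigr => j _; rewrite mulrDr mulrBr.
have Mu : M \in unitmx.
  rewrite -row_free_unit -kermx_eq0; apply/rowV0P => u /sub_kermxP uM.
  apply/rowP => j; rewrite mxE -(enum_valK j).
  by apply: (Z_inj (ev u)) => s; rewrite -MZ uM mxE.
exists (ev ((\row_i f (enum_val i)) *m invmx M)) => s.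
by rewrite -MZ mulmxKV// mxE enum_rankK.
Qed.

End FiniteChain.

(** * Expectations over histories *)

Section Trajectory.
Context {R : realType} {S A W : finType}.
Context {dO : measure_display} {Omega : measurableType dO}.
Variable Pm : probability Omega R.
Variables (st : nat -> Omega -> S) (at_ : nat -> Omega -> A) (rt : nat -> Omega -> W).
Hypothesis Hst_meas : forall t x, measurable [set om | st t om = x].
Hypothesis Hat_meas : forall t x, measurable [set om | at_ t om = x].
Hypothesis Hrt_meas : forall t x, measurable [set om | rt t om = x].

(** The history includes the state at time [n] but neither the action nor the reward of that time:
    its classes are exactly the events to which [traj_law] gives a probability. *)
Definition same_past (n : nat) (om om' : Omega) : Prop :=
  (forall i, (i < n)%N ->
     [/\ st i om = st i om', at_ i om = at_ i om' & rt i om = rt i om'])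
  /\ st n om = st n om'.

(** Measurability for the finite sigma-algebra of histories, phrased as a factorization so that [X]
    can be a space of vectors or of functions without any measurable structure. *)
Definition past_measurable {X : Type} (n : nat) (f : Omega -> X) : Prop :=
  forall om om', same_past n om om' -> f om = f om'.

Lemma same_pastW m n om om' : (m <= n)%N -> same_past n om om' -> same_past m om om'.
Proof.
move=> mn [h1 h2]; split=> [i im|]; first exact/h1/(leq_trans im).
by move: mn; rewrite leq_eqVlt => /predU1P[->//|/h1[]].
Qed.

Lemma past_measurableW {X : Type} m n (f : Omega -> X) : (m <= n)%N ->
  past_measurable m f -> past_measurable n f.
Proof. by move=> mn fm om om' /(same_pastW mn)/fm. Qed.

Lemma past_measurable_comp2 {X Y Z : Type} n (f : Omega -> X) (g : Omega -> Y)
    (k : X -> Y -> Z) : past_measurable n f -> past_measurable n g ->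
  past_measurable n (fun om => k (f om) (g om)).
Proof. by move=> fm gm om om' h; rewrite (fm _ _ h) (gm _ _ h). Qed.

Lemma past_measurable_st n : past_measurable n (st n).
Proof. by move=> om om' []. Qed.

Definition past (n : nat) (om : Omega) : {ffun 'I_n -> S * A * W} * S :=
  ([ffun i : 'I_n => (st i om, at_ i om, rt i om)], st n om).

Lemma pastP n om om' : past n om = past n om' <-> same_past n om om'.
Proof.
split=> [[/ffunP h1 h2]|[h1 h2]]; last first.
  congr (_, _) => //; apply/ffunP => i; rewrite !ffunE.
  by have [-> -> ->] := h1 i (ltn_ord i).
by split=> // i im; have := h1 (Ordinal im); rewrite !ffunE/= => -[].
Qed.

Lemma measurable_same_past n om0 : measurable [set om | same_past n om om0].
Proof.
rewrite (_ : mkset _ = [set om | forall i, (i < n)%N ->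
     [/\ st i om = st i om0, at_ i om = at_ i om0 & rt i om = rt i om0]]
   `&` [set om | st n om = st n om0])//.
apply: measurableI => //; elim: n => [|n IH].
  by rewrite (_ : mkset _ = setT)//; apply/seteqP; split.
rewrite (_ : mkset _ = [set om | forall i, (i < n)%N ->
     [/\ st i om = st i om0, at_ i om = at_ i om0 & rt i om = rt i om0]] `&`
   ([set om | st n om = st n om0] `&`
   ([set om | at_ n om = at_ n om0] `&` [set om | rt n om = rt n om0]))).
  by do 3![apply: measurableI => //].
apply/seteqP; split=> om /= h.
  by split=> [i im|]; [exact/h/ltnW|have [] := h n (ltnSn n)].
case: h => h [h1 [h2 h3]] i; rewrite ltnS leq_eqVlt => /predU1P[->//|].
exact: h.
Qed.

Lemma measurable_past n h : measurable [set om | past n om = h].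
Proof.
have [[om0 <-]|ne] := pselect (exists om0, past n om0 = h).
  rewrite (_ : mkset _ = [set om | same_past n om om0]).
    exact: measurable_same_past.
  by apply/seteqP; split=> om /= /pastP.
rewrite (_ : mkset _ = set0)//; apply/seteqP; split=> om //= omh.
by apply: ne; exists om.
Qed.

Lemma past_measurable_factor n (f : Omega -> R) : past_measurable n f ->
  exists F, forall om, f om = F (past n om).
Proof.
(* A history realized by no outcome receives the default 0; any other is evaluated at a chosen
   representative. *)
move=> fm; exists (fun h => if pselect (exists om0, past n om0 = h) is left e
                    then f (projT1 (cid e)) else 0) => om.
case: pselect => [e|]; last by case; exists om.
by case: (cid e) => om0 /= /pastP /fm.
Qed.

Lemma past_measurable_bounded n (f : Omega -> R) : past_measurable n f ->
  exists M, forall om, `|f om| <= M.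
Proof.
move=> /past_measurable_factor[F fF]; exists (\sum_h `|F h|) => om.
by rewrite fF (bigD1 (past n om))//= lerDl sumr_ge0.
Qed.

Lemma past_measurable_measurable n (f : Omega -> R) : past_measurable n f ->
  measurable_fun setT f.
Proof.
move=> /past_measurable_factor[F fF].
rewrite (_ : f = fun om => \sum_h F h * \1_[set om | past n om = h] om).
  apply: measurable_sum => h; apply: measurable_funM => //.
  exact/measurable_indic/measurable_past.
apply/funext => om; rewrite fF (bigD1 (past n om))//= big1 => [|h hn].
  by rewrite indicE mem_set// mulr1 addr0.
by rewrite indicE memNset ?mulr0// => /esym/eqP; exact/negP.
Qed.

Lemma past_measurable_integrable n (f : Omega -> R) : past_measurable n f ->
  Pm.-integrable setT (EFin \o f).
Proof.
move=> fm; apply: measurable_bounded_integrable => //.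
- exact: le_lt_trans (probability_le1 Pm measurableT) (ltry _).
- exact: past_measurable_measurable fm.
- have [M fM] := past_measurable_bounded fm.
  by exists M; split; [exact: num_real|move=> x Mx om _; exact: le_trans (fM om) (ltW Mx)].
Qed.

(** The horizon is hidden so that functions known at different times can be combined; each takes
    finitely many values and is therefore integrable. *)
Definition simple (f : Omega -> R) : Prop := exists n, past_measurable n f.

Lemma simple2 (f g : Omega -> R) (k : R -> R -> R) : simple f -> simple g ->
  simple (fun om => k (f om) (g om)).
Proof.
move=> [m fm] [n gn]; exists (maxn m n); apply: past_measurable_comp2.
  exact: past_measurableW (leq_maxl _ _) fm.
exact: past_measurableW (leq_maxr _ _) gn.
Qed.

Lemma simple_cst (c : R) : simple (fun=> c). Proof. by exists 0%N. Qed.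

Lemma simpleD f g : simple f -> simple g -> simple (fun om => f om + g om).
Proof. exact: simple2. Qed.

Lemma simpleB f g : simple f -> simple g -> simple (fun om => f om - g om).
Proof. exact: (@simple2 _ _ (fun x y => x - y)). Qed.

Lemma simpleM f g : simple f -> simple g -> simple (fun om => f om * g om).
Proof. exact: simple2. Qed.

Lemma simpleZ c f : simple f -> simple (fun om => c * f om).
Proof. exact/simpleM/simple_cst. Qed.

Lemma simple_sum (I : Type) (r : seq I) (f : I -> Omega -> R) :
  (forall i, simple (f i)) -> simple (fun om => \sum_(i <- r) f i om).
Proof.
move=> fs; elim: r => [|i r IH].
  by under eq_fun do rewrite big_nil; exact: simple_cst.
by under eq_fun do rewrite big_cons; exact: simpleD.
Qed.

Lemma simple_integrable f : simple f -> Pm.-integrable setT (EFin \o f).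
Proof. by move=> [n /past_measurable_integrable]. Qed.

Definition Ex (f : Omega -> R) : R := \int[Pm]_om f om.

(** Bridge between the extended integrals of the theorem and the real-valued [Ex] in which the
    computations are done. *)
Lemma EFin_Ex f : simple f -> (\int[Pm]_om (f om)%:E)%E = (Ex f)%:E.
Proof.
by move=> fs; rewrite fineK//; apply: integrable_fin_num => //; exact: simple_integrable.
Qed.

Lemma ExD f g : simple f -> simple g -> Ex (fun om => f om + g om) = Ex f + Ex g.
Proof. by move=> fs gs; apply: RintegralD => //; exact: simple_integrable. Qed.

Lemma ExB f g : simple f -> simple g -> Ex (fun om => f om - g om) = Ex f - Ex g.
Proof. by move=> fs gs; apply: RintegralB => //; exact: simple_integrable. Qed.

Lemma ExZ c f : simple f -> Ex (fun om => c * f om) = c * Ex f.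
Proof. by move=> fs; apply: RintegralZl => //; exact: simple_integrable. Qed.

Lemma Ex_cst c : Ex (fun=> c) = c.
Proof.
rewrite /Ex Rintegral_cst// -[RHS]mulr1; congr (_ * _).
by rewrite -[RHS]/(fine 1%E) -(probability_setT Pm).
Qed.

Lemma Ex_le f g : simple f -> simple g -> (forall om, f om <= g om) -> Ex f <= Ex g.
Proof. by move=> fs gs fg; apply: le_Rintegral => //; exact: simple_integrable. Qed.

Lemma Ex_norm_le f g : simple f -> simple g -> (forall om, `|f om| <= g om) ->
  `|Ex f| <= Ex g.
Proof.
move=> fs gs fg; rewrite ler_norml -[X in - X]mul1r -mulNr -ExZ//.
apply/andP; split; last first.
  by apply: Ex_le => // om; have := fg om; rewrite ler_norml => /andP[].
apply: Ex_le => // [|om]; first exact: simpleZ.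
by rewrite mulN1r; have := fg om; rewrite ler_norml => /andP[].
Qed.

Lemma Ex_sum (I : Type) (r : seq I) (f : I -> Omega -> R) :
  (forall i, simple (f i)) ->
  Ex (fun om => \sum_(i <- r) f i om) = \sum_(i <- r) Ex (f i).
Proof.
move=> fs; elim: r => [|i r IH].
  by rewrite big_nil; under eq_fun do rewrite big_nil; rewrite Ex_cst.
rewrite big_cons; under eq_fun do rewrite big_cons.
by rewrite ExD ?IH//; exact: simple_sum.
Qed.

Lemma Ex_indic (B : set Omega) : measurable B -> Ex (\1_B) = fine (Pm B).
Proof. by move=> mB; rewrite /Ex /Rintegral integral_indic// setIT. Qed.

Lemma eq_indic (B : set Omega) om om' : (B om <-> B om') -> \1_B om = \1_B om' :> R.
Proof.
move=> h; rewrite !indicE; have [Bom|nBom] := pselect (B om).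
  by rewrite !mem_set//; exact/h.
by rewrite !memNset// => /h.
Qed.

Lemma simple_past n h : simple (\1_[set om | past n om = h]).
Proof.
by exists n => om om' /pastP e; apply: eq_indic => /=; rewrite e.
Qed.

Lemma Ex_past n f : simple f ->
  Ex f = \sum_h Ex (fun om => f om * \1_[set om | past n om = h] om).
Proof.
move=> fs; rewrite -Ex_sum => [|h]; last by apply: simpleM => //; exact: simple_past.
congr Ex; apply/funext => om; rewrite -mulr_sumr (bigD1 (past n om))//= big1 => [|h hn].
  by rewrite indicE mem_set// addr0 mulr1.
by rewrite indicE memNset// => /esym/eqP; exact/negP.
Qed.

Variables (P : S -> A -> S -> R) (Pr : S -> A -> W -> R) (b : S -> A -> R) (nu : S -> R).
Hypothesis Hlaw : traj_law P Pr b Pm nu st at_ rt.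

(** The law at lengths [n] and [n.+1], applied to the same sequences, gives two products differing
    by one factor. A product rather than a quotient keeps the identity true on histories of
    probability zero. *)
Lemma traj_law_step n om0 a w s' :
  fine (Pm ([set om | past n om = past n om0] `&`
            [set om | [/\ at_ n om = a, rt n om = w & st n.+1 om = s']])) =
  b (st n om0) a * Pr (st n om0) a w * P (st n om0) a s' *
  fine (Pm [set om | past n om = past n om0]).
Proof.
(* The sequences follow [om0] through the history and branch off with [a], [w] at time [n] and [s']
   at time [n.+1]. *)
pose xs i := if i == n.+1 then s' else st i om0.
pose ys i := if i == n then a else at_ i om0.
pose ws i := if i == n then w else rt i om0.
have xsE i : (i <= n)%N -> xs i = st i om0.
  by rewrite /xs; case: eqP => // ->; rewrite ltnn.
have ysE i : (i < n)%N -> ys i = at_ i om0.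
  by rewrite /ys; case: eqP => // ->; rewrite ltnn.
have wsE i : (i < n)%N -> ws i = rt i om0.
  by rewrite /ws; case: eqP => // ->; rewrite ltnn.
have xn1 : xs n.+1 = s' by rewrite /xs eqxx.
have yn : ys n = a by rewrite /ys eqxx.
have wn : ws n = w by rewrite /ws eqxx.
have := Hlaw n.+1 xs ys ws; have := Hlaw n xs ys ws.
rewrite (_ : [set om | _ /\ st n om = xs n] = [set om | past n om = past n om0]).
  move=> ->; rewrite (_ : [set om | _ /\ st n.+1 om = xs n.+1] =
     [set om | past n om = past n om0] `&`
     [set om | [/\ at_ n om = a, rt n om = w & st n.+1 om = s']]).
    by move=> ->; rewrite /= big_ord_recr/= xn1 yn wn (xsE n)// [in LHS]mulrA mulrC.
  apply/seteqP; split=> om /=.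
    move=> [h1]; rewrite xn1 => ->; have [h2 h3 h4] := h1 n (ltnSn n).
    split; last by rewrite -yn -wn.
    apply/pastP; split; last by rewrite h2 xsE.
    by move=> i im; have [-> -> ->] := h1 i (ltnW im); rewrite xsE ?ysE ?wsE ?(ltnW im).
  move=> [/pastP[h1 h2] [h3 h4 h5]]; split; last by rewrite xn1.
  move=> i; rewrite ltnS leq_eqVlt => /predU1P[->|im].
    by rewrite xsE// yn wn.
  by have [-> -> ->] := h1 i im; rewrite xsE ?ysE ?wsE ?(ltnW im).
apply/seteqP; split=> om /=.
  move=> [h1 h2]; apply/pastP; split; last by rewrite h2 xsE.
  by move=> i im; have [-> -> ->] := h1 i im; rewrite xsE ?ysE ?wsE ?(ltnW im).
move=> /pastP[h1 h2]; split; last by rewrite h2 xsE.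
by move=> i im; have [-> -> ->] := h1 i im; rewrite xsE ?ysE ?wsE ?(ltnW im).
Qed.

(** On each history [f] and the transition weight are constant, so the claim reduces to
    [traj_law_step] one history at a time; an unrealized history contributes 0 to both sides. *)
Lemma markov_indic n (f : Omega -> R) a w s' : past_measurable n f ->
  Ex (fun om => f om * \1_[set om | [/\ at_ n om = a, rt n om = w & st n.+1 om = s']] om) =
  Ex (fun om => f om * (b (st n om) a * Pr (st n om) a w * P (st n om) a s')).
Proof.
move=> fm; set B := [set om | _].
have fs : simple f by exists n.
have Bs : simple (\1_B).
  exists n.+1 => om om' [h1 h2]; apply: eq_indic; rewrite /B/=.
  by have [_ -> ->] := h1 n (ltnSn n); rewrite h2.
have ps : simple (fun om => b (st n om) a * Pr (st n om) a w * P (st n om) a s').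
  by exists n => om om' [_ ->].
rewrite (Ex_past n)/=; last exact: simpleM.
rewrite [RHS](Ex_past n)/=; last exact: simpleM.
apply: eq_bigr => h _.
have [[om0 <-]|ne] := pselect (exists om0, past n om0 = h); last first.
  congr Ex; apply/funext => om; rewrite [\1_[set _ | _ = h] om]indicE memNset ?mulr0//= => omh.
  by apply: ne; exists om.
transitivity (Ex (fun om => f om0 * \1_([set om | past n om = past n om0] `&` B) om)).
  congr Ex; apply/funext => om; rewrite indicI/=.
  rewrite [\1_[set _ | _] om]indicE; case: (boolP (om \in _)) => [|_]; last by rewrite !(mulr0, mul0r).
  by rewrite inE/= => /pastP/fm ->; rewrite mulr1 mul1r.
transitivity (Ex (fun om => (f om0 * (b (st n om0) a * Pr (st n om0) a w * P (st n om0) a s'))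
                 * \1_[set om | past n om = past n om0] om)); last first.
  congr Ex; apply/funext => om.
  rewrite indicE; case: (boolP (om \in _)) => [|_]; last by rewrite !mulr0.
  by rewrite inE/= => /pastP omn; rewrite -(fm _ _ omn) (proj2 omn).
have mB : measurable B.
  rewrite (_ : B = [set om | at_ n om = a] `&` ([set om | rt n om = w] `&` [set om | st n.+1 om = s'])).
    by do 2![apply: measurableI => //].
  by apply/seteqP; split=> om [h1]; [move=> h2 h3|move=> []].
rewrite !ExZ ?Ex_indic ?traj_law_step ?mulrA//.
- exact: measurable_past.
- by apply: measurableI => //; exact: measurable_past.
- exact: simple_past.
- by rewrite indicI; apply: simpleM => //; exact: simple_past.
Qed.

(** The tower property in a form free of conditional expectations: the transition at time [n] is
    integrated out of an integrand whose other arguments are known by then. *)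
Lemma markov n (k : Omega -> A -> W -> S -> R) :
  (forall a w s', past_measurable n (fun om => k om a w s')) ->
  Ex (fun om => k om (at_ n om) (rt n om) (st n.+1 om)) =
  Ex (fun om => \sum_a \sum_w \sum_s' k om a w s' *
        (b (st n om) a * Pr (st n om) a w * P (st n om) a s')).
Proof.
move=> km.
have ks a w s' : simple (fun om => k om a w s' *
    (b (st n om) a * Pr (st n om) a w * P (st n om) a s')).
  by exists n => om om' h; rewrite (km _ _ _ _ _ h) (proj2 h).
have Is a w s' : simple (fun om => k om a w s' *
    \1_[set om | [/\ at_ n om = a, rt n om = w & st n.+1 om = s']] om).
  exists n.+1 => om om' h; rewrite (km _ _ _ _ _ (same_pastW (leqnSn n) h)).
  congr (_ * _); apply: eq_indic => /=.
  by have [_ -> ->] := (proj1 h) n (ltnSn n); rewrite (proj2 h).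
transitivity (Ex (fun om => \sum_a \sum_w \sum_s' k om a w s' *
    \1_[set om | [/\ at_ n om = a, rt n om = w & st n.+1 om = s']] om)).
  congr Ex; apply/funext => om.
  rewrite (bigD1 (at_ n om))//= [X in _ + X]big1 ?addr0 => [|a /eqP na]; last first.
    apply: big1 => w _; apply: big1 => s' _; rewrite indicE memNset ?mulr0//= => -[].
    by move/esym.
  rewrite (bigD1 (rt n om))//= [X in _ + X]big1 ?addr0 => [|w /eqP nw]; last first.
    by apply: big1 => s' _; rewrite indicE memNset ?mulr0//= => -[_ /esym].
  rewrite (bigD1 (st n.+1 om))//= [X in _ + X]big1 ?addr0 => [|s' /eqP ns]; last first.
    by rewrite indicE memNset ?mulr0//= => -[_ _ /esym].
  by rewrite indicE mem_set ?mulr1.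
rewrite !Ex_sum => [|a|a]; last 2 first.
- by apply: simple_sum => w; exact: simple_sum.
- by apply: simple_sum => w; exact: simple_sum.
apply: eq_bigr => a _; rewrite !Ex_sum => [|w|w]; last 2 first.
- exact: simple_sum.
- exact: simple_sum.
apply: eq_bigr => w _; rewrite !Ex_sum//; apply: eq_bigr => s' _.
exact: markov_indic.
Qed.

End Trajectory.

(** * Step sizes and real recursions *)

Section RealSequences.
Context {R : realType}.
Implicit Types (c K : R) (eta D B u : nat -> R).

(** With [a = c eta / 2] the recursion is [a -> a exp(-a)], and the claim becomes
    [1/(2t) <= a_t <= 1/t]. The upper bound uses [exp(a) >= 1 + a]. The lower one uses
    [exp(-a) >= 1 - a] and the monotonicity of [a (1 - a)] on [[0, 1/2]]. *)
Lemma exp_step_bounds c eta : 0 < c -> c^-1 <= eta 1%N <= 2 / c ->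
  (forall t, (0 < t)%N -> eta t.+1 = expR (- (2^-1 * c * eta t)) * eta t) ->
  forall t, (0 < t)%N -> (c * t%:R)^-1 <= eta t <= 2 / (c * t%:R).
Proof.
move=> c0 eta1 etaS.
pose a t := 2^-1 * c * eta t.
have aS t : (0 < t)%N -> a t.+1 = expR (- a t) * a t.
  by move=> t0; rewrite {1}/a etaS// mulrCA.
suff ab t : (0 < t)%N -> (2 * t%:R)^-1 <= a t <= t%:R^-1.
  move=> t t0; have /andP[a1 a2] := ab t t0.
  have -> : eta t = 2 / c * a t by rewrite /a; field; rewrite gt_eqF.
  have T0 : 0 < t%:R :> R by rewrite ltr0n.
  have c20 : 0 < 2 / c by rewrite divr_gt0.
  rewrite (_ : 2 / (c * _) = 2 / c * t%:R^-1); last by field; rewrite !gt_eqF.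
  rewrite (_ : (c * _)^-1 = 2 / c * (2 * t%:R)^-1); last by field; rewrite !gt_eqF.
  by rewrite !ler_pM2l// a1.
elim: t => // -[_ _|t IH _].
  move: eta1 => /andP[h1 h2]; rewrite mulr1 invr1.
  move: h1 h2; rewrite ler_pdivlMr// -div1r ler_pdivrMr// /a => h1 h2; lra.
have {IH} /andP[IH1 IH2] := IH isT.
set T : R := t.+1%:R in IH1 IH2 *; have T1 : 1 <= T by rewrite ler1n.
have -> : t.+2%:R = T + 1 by rewrite -natr1.
rewrite aS//; set x := a t.+1 in IH1 IH2 *.
have x0 : 0 < x by apply: lt_le_trans IH1; rewrite invr_gt0; lra.
apply/andP; split; last first.
  rewrite expRN mulrC ler_pdivrMr ?expR_gt0// mulrC ler_pdivlMr; last lra.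
  have := expR_ge1Dx x; suff : x * (T + 1) <= 1 + x by lra.
  by move: IH2; rewrite -div1r ler_pdivlMr; lra.
(* At time 1, [x] may reach 1, beyond the range where [x (1 - x)] increases; the sharper
   [exp(-x) >= (1 - x/2)^2] is used there. *)
have [t0|t0] := posnP t.
  have T1' : T = 1 by rewrite /T t0.
  move: IH1 IH2; rewrite T1' mulr1 invr1 => x1 x2.
  have e1 := expR_ge1Dx (- (x / 2)).
  have -> : expR (- x) = expR (- (x / 2)) ^+ 2.
    by rewrite expr2 -expRD; congr expR; field.
  have e2 : (1 - x / 2) ^+ 2 <= expR (- (x / 2)) ^+ 2.
    by rewrite ler_pXn2r ?nnegrE ?expR_ge0//; lra.
  apply: le_trans (ler_wpM2r (ltW x0) e2).
  rewrite -div1r ler_pdivrMr; last lra.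
  (* This product equals [x (2 - x)^2 - 1], and its second factor is positive on [[1/2, 1]]. *)
  have : 0 <= (1 - x) * (3 * x - x ^+ 2 - 1).
    by apply: mulr_ge0; [lra|nra].
  by nra.
have T2 : 2 <= T by rewrite ler_nat ltnS.
have e1 := expR_ge1Dx (- x).
apply: le_trans (ler_wpM2r (ltW x0) e1).
have xT : x <= 2^-1 by apply: le_trans IH2 _; rewrite lef_pV2 ?posrE; lra.
apply: (@le_trans _ _ ((1 - (2 * T)^-1) * (2 * T)^-1)); last first.
  by move: IH1; set y := _^-1 => IH1; nra.
rewrite -subr_ge0 (_ : _ - _ = (2 * T - 2) / (4 * T ^+ 2 * (T + 1) * 2)).
  by rewrite divr_ge0; nra.
by field; rewrite !gt_eqF; lra.
Qed.

(** The corrector is moved into the Lyapunov function [V n = D n - 2 eta_{n+1} u n], which differs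
    from [D n] by [O(1/n)] and satisfies a scalar contraction with an error of order [eta^2]. *)
Lemma inv_rate_of_recursion c K eta D u (N0 : nat) :
  0 < c -> 0 < K ->
  c^-1 <= eta 1%N <= 2 / c ->
  (forall t, (0 < t)%N -> eta t.+1 = expR (- (2^-1 * c * eta t)) * eta t) ->
  (forall n, `|u n| <= K) -> (forall n, 0 <= D n <= K) ->
  (forall n kappa, (N0 <= n)%N -> 0 < kappa ->
    D n.+1 <= D n - 2 * eta n.+1 * (c * D n + u n - u n.+1)
      + K * eta n.+1 * (kappa / n.+1%:R + D n / kappa + n.+1%:R^-1)
      + K * eta n.+1 ^+ 2) ->
  exists K', forall n, D n <= K' / n.+1%:R.
Proof.
move=> c0 K0 eta1 etaS uK DK rec.
have etab := exp_step_bounds c0 eta1 etaS.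
have eta_bd n : (n.+1%:R)^-1 <= c * eta n.+1 /\ c * eta n.+1 <= 2 / n.+1%:R.
  have /andP[h1 h2] := etab n.+1 isT; have n0 : n.+1%:R != 0 :> R by rewrite pnatr_eq0.
  have c0' : c != 0 by rewrite gt_eqF.
  move: n.+1%:R n0 h1 h2 => t n0 h1 h2.
  rewrite -(ler_pM2l c0) in h1; rewrite -(ler_pM2l c0) in h2; split.
    by rewrite (_ : t^-1 = c * (c * t)^-1)//; field; rewrite n0.
  by rewrite (_ : 2 / t = c * (2 / (c * t)))//; field; rewrite n0.
have eta0 n : 0 < eta n.+1.
  have [h _] := eta_bd n; rewrite -(pmulr_rgt0 _ c0).
  by apply: lt_le_trans h; rewrite invr_gt0 ltr0n.
(* With this weight [K eta D / kappa = c eta D / 2], a quarter of the drift [2 c eta D]. *)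
pose kappa := 2 * K / c; have kappa0 : 0 < kappa by rewrite divr_gt0// mulr_gt0.
(* The first summand comes from [1/(n+1) <= c eta_{n+1}]. In [4 c K], one part pays for
   [2 (eta_{n+1} - eta_{n+2}) u_{n+1}] and three for replacing [D] by [V] in the drift. *)
pose K3 := K * (kappa + 1) * c + K + 4 * c * K.
pose V n := D n - 2 * eta n.+1 * u n.
have Vrec n : (N0 <= n)%N ->
    V n.+1 <= (1 - 3 / 2 * (c * eta n.+1)) * V n + K3 * eta n.+1 ^+ 2.
  move=> nN; have := rec n kappa nN kappa0.
  have -> : D n / kappa = c * D n / (2 * K).
    by rewrite /kappa; field; rewrite !gt_eqF.
  have [ti _] := eta_bd n.
  have deta : eta n.+1 - eta n.+2 <= c / 2 * eta n.+1 ^+ 2.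
    by rewrite (etaS n.+1)//; have := ler_wpM2r (ltW (eta0 n)) (expR_ge1Dx (- (2^-1 * c * eta n.+1))); lra.
  have deta0 : 0 <= eta n.+1 - eta n.+2.
    rewrite (etaS n.+1)// subr_ge0 -[leRHS]mul1r ler_wpM2r ?(ltW (eta0 n))// expR_le1.
    by rewrite oppr_le0 !mulr_ge0 ?(ltW (eta0 n))// ltW.
  rewrite /V /K3; have := uK n; have := uK n.+1; rewrite !ler_norml.
  have := eta0 n; move: ti deta deta0.
  set e := eta n.+1; set e' := eta n.+2; set i := _^-1; set x := D n; set x' := D n.+1.
  set v := u n; set v' := u n.+1 => ti deta deta0 e0 /andP[v'1 v'2] /andP[v1 v2].
  have -> : K * e * (kappa * i + c * x / (2 * K) + i) =
            K * (kappa + 1) * e * i + 2^-1 * c * e * x.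
    by field; rewrite gt_eqF.
  have h1 : K * (kappa + 1) * e * i <= K * (kappa + 1) * c * e ^+ 2.
    rewrite (_ : K * (kappa + 1) * c * e ^+ 2 = K * (kappa + 1) * e * (c * e)); last by ring.
    by rewrite ler_wpM2l// !mulr_ge0//; lra.
  have h2 : (e - e') * v' <= c / 2 * e ^+ 2 * K.
    by apply: (@le_trans _ _ ((e - e') * K)); [rewrite ler_wpM2l|rewrite ler_wpM2r//; lra].
  have h3 : - (c * e ^+ 2 * K) <= c * e ^+ 2 * v.
    by rewrite -mulrN ler_wpM2l// mulr_ge0 ?sqr_ge0; lra.
  by move=> h; nra.
pose K4 := K3 * 4 / c ^+ 2.
have K3p : 0 <= K3 by rewrite /K3 !addr_ge0 ?mulr_ge0//; lra.
(* From [n = 3] on, [c eta_{n+1} <= 2/(n+1) <= 1/2], so the contraction factor is nonnegative and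
   the induction hypothesis can be multiplied by it. *)
pose N1 := maxn N0 3.
have KcV n : V n <= K + 4 * K / c.
  rewrite /V; have /andP[_ Dn] := DK n; have := uK n; rewrite ler_norml => /andP[u1 _].
  have [_ h] := eta_bd n; have e0 := eta0 n.
  have t1 : 2 / n.+1%:R <= 2 :> R.
    by rewrite ler_pdivrMr ?ltr0n// ler_peMr// ler1n.
  have e2 : eta n.+1 <= 2 / c by rewrite ler_pdivlMr// mulrC (le_trans h).
  have : - (2 * eta n.+1 * u n) <= 4 * K / c.
    apply: (@le_trans _ _ (2 * eta n.+1 * K)); first by rewrite -mulrN ler_wpM2l ?mulr_ge0//; lra.
    rewrite (_ : 4 * K / c = 2 * K * (2 / c)); last by ring.
    by rewrite mulrAC ler_wpM2l// mulr_ge0// ltW.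
  by move=> ?; lra.
(* The second summand settles the base case. The first closes the induction: with [i = 1/t],
   [K4 i^2 <= M i^2 / 2] leaves [M i - M i^2 <= M / (t + 1)]. *)
pose M := 2 * K4 + N1.+1%:R * (K + 4 * K / c).
have K4p : 0 <= K4 by rewrite /K4 divr_ge0 ?sqr_ge0// mulr_ge0.
have Kcp : 0 <= K + 4 * K / c by rewrite addr_ge0 ?divr_ge0 ?mulr_ge0//; lra.
have VM n : (N1 <= n)%N -> V n <= M / n.+1%:R.
  elim: n => [|n IH]; first by rewrite leqn0 /N1 maxnE; case: (N0).
  rewrite leq_eqVlt => /predU1P[nN|]; [|rewrite ltnS => nN].
    rewrite -nN ler_pdivlMr ?ltr0n// mulrC (le_trans (ler_wpM2l _ (KcV _)))//.
    by rewrite lerDr mulr_ge0.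
  have := Vrec n (leq_trans (leq_maxl _ _) nN); have {IH} := IH nN.
  have [h1 h2] := eta_bd n; have e0 := eta0 n.
  have t4 : 4 <= n.+1%:R :> R by rewrite ler_nat ltnS (leq_trans (leq_maxr _ _) nN).
  have -> : n.+2%:R = n.+1%:R + 1 :> R by rewrite natr1.
  move: h1 h2 e0 t4; set e := eta n.+1; set t : R := n.+1%:R => h1 h2 e0 t4 Vn VSn.
  clearbody e t.
  apply: (le_trans VSn).
  have ti0 : 0 < t^-1 by rewrite invr_gt0; lra.
  have ti4 : t^-1 <= 4^-1 by rewrite lef_pV2 ?posrE//; lra.
  have f0 : 0 <= 1 - 3 / 2 * (c * e) by lra.
  have Mp : 0 <= M by rewrite /M addr_ge0// mulr_ge0.
  have s1 : (1 - 3 / 2 * (c * e)) * V n <= (1 - 3 / 2 * t^-1) * (M / t).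
    apply: (le_trans (ler_wpM2l f0 Vn)); rewrite ler_wpM2r ?divr_ge0//; first lra.
    lra.
  have s2 : K3 * e ^+ 2 <= K4 * t^-1 ^+ 2.
    rewrite (_ : K4 * _ = K3 * (2 / t / c) ^+ 2); last first.
      by rewrite /K4; field; rewrite !gt_eqF//; lra.
    rewrite ler_wpM2l// ler_pXn2r ?nnegrE ?divr_ge0 ?(ltW e0) ?(ltW c0)//; last by lra.
    by rewrite ler_pdivlMr// mulrC.
  have MK4 : 2 * K4 <= M by rewrite /M lerDl mulr_ge0.
  have -> : M / (t + 1) = M * t^-1 - M * t^-1 ^+ 2 + M * t^-1 ^+ 2 / (t + 1).
    by field; rewrite !gt_eqF//; lra.
  have : 0 <= M * t^-1 ^+ 2 / (t + 1) by rewrite divr_ge0 ?mulr_ge0 ?sqr_ge0//; lra.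
  have : 2 * K4 * t^-1 ^+ 2 <= M * t^-1 ^+ 2 by rewrite ler_wpM2r ?sqr_ge0.
  by move: s1 s2; set i := t^-1; nra.
exists (M + 4 * K / c + K * N1.+1%:R) => n.
have t0 : 0 < n.+1%:R :> R by rewrite ltr0n.
have Mp : 0 <= M by rewrite /M addr_ge0// mulr_ge0.
have Kc0 : 0 <= 4 * K / c by rewrite divr_ge0// ?mulr_ge0//; lra.
have /andP[_ DnK] := DK n.
have [nN|nN] := leqP N1 n; last first.
  rewrite ler_pdivlMr// (le_trans (ler_wpM2r (ltW t0) DnK))//.
  apply: (@le_trans _ _ (K * N1.+1%:R)); last by rewrite lerDr addr_ge0.
  by rewrite (ler_wpM2l (ltW K0))// ler_nat ltnS ltnW// ltnW.
have := VM n nN; rewrite /V lerBlDr => h; apply: (le_trans h).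
have [_ h2] := eta_bd n; have e0 := eta0 n.
have := uK n; rewrite ler_norml => /andP[_ u2].
rewrite ler_pdivlMr// mulrDl mulrAC -mulrA divff ?gt_eqF// mulr1.
have : 2 * eta n.+1 * u n * n.+1%:R <= 4 * K / c.
  apply: (@le_trans _ _ (2 * eta n.+1 * K * n.+1%:R)).
    by rewrite ler_wpM2r ?ler_wpM2l// ?mulr_ge0//; lra.
  rewrite ler_pdivlMr//; move: h2; rewrite ler_pdivlMr// => h2.
  rewrite (_ : _ * c = 2 * K * (c * eta n.+1 * n.+1%:R)); last by ring.
  by rewrite (_ : 4 * K = 2 * K * 2) ?ler_wpM2l// ?mulr_ge0//; lra || ring.
have : 0 <= K * N1.+1%:R by rewrite mulr_ge0// ltW.
lra.
Qed.

Lemma inv_sqrt_le_sub (n : nat) :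
  (Num.sqrt n.+1%:R)^-1 <= 2 * (Num.sqrt n.+1%:R - Num.sqrt n%:R) :> R.
Proof.
have s0 : 0 < Num.sqrt n.+1%:R :> R by rewrite sqrtr_gt0 ltr0n.
have e1 : Num.sqrt n.+1%:R ^+ 2 = Num.sqrt n%:R ^+ 2 + 1 :> R.
  by rewrite !sqr_sqrtr ?ler0n// natr1.
have := sqrtr_ge0 (n%:R : R); move: s0 e1.
set x := Num.sqrt n.+1%:R; set y := Num.sqrt n%:R => x0 e1 y0.
rewrite -div1r ler_pdivrMr//; have : 0 <= (x - y) ^+ 2 by exact: sqr_ge0.
by nra.
Qed.

(** After division by the step size, [sqrt n (D_n - D_{n+1})] is summed by parts: [D] is bounded, so
    the increments of the square root add up to [O(sqrt T)], and the corrector telescopes. *)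
Lemma sqrt_rate_of_recursion (eta0 K : R) eta D B u (N0 : nat) :
  0 < eta0 -> 0 < K ->
  (forall t, (0 < t)%N -> eta t = eta0 / Num.sqrt t%:R) ->
  (forall n, `|u n| <= K) -> (forall n, 0 <= D n <= K) -> (forall n, B n <= K) ->
  (forall n kappa, (N0 <= n)%N -> 0 < kappa ->
    D n.+1 <= D n - 2 * eta n.+1 * (B n + u n - u n.+1)
      + K * eta n.+1 * (kappa / n.+1%:R + D n / kappa + n.+1%:R^-1)
      + K * eta n.+1 ^+ 2) ->
  exists (K' : R) (T0 : nat), forall T : nat, (T0 <= T)%N ->
     \sum_(n < T) B n <= K' * Num.sqrt T%:R.
Proof.
move=> eta00 K0 etaE uK DK BK rec.
pose K5 := K * (K + 2) + K * eta0.
have K50 : 0 < K5 by rewrite addr_gt0 ?mulr_gt0// addr_gt0.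
have step n : (N0 <= n)%N ->
    2 * B n <= Num.sqrt n.+1%:R * (D n - D n.+1) / eta0 - 2 * (u n - u n.+1)
       + K5 / Num.sqrt n.+1%:R.
  move=> nN; have s0 : 0 < Num.sqrt n.+1%:R :> R by rewrite sqrtr_gt0 ltr0n.
  (* Here [kappa] is [sqrt (n+1)], which makes [kappa / (n+1)] and [D n / kappa] both of order
     [1 / sqrt (n+1)]. *)
  have := rec n _ nN s0; rewrite etaE//.
  have st2 : Num.sqrt n.+1%:R ^+ 2 = n.+1%:R :> R by rewrite sqr_sqrtr.
  have s1 : 1 <= Num.sqrt n.+1%:R :> R.
    by rewrite -[leLHS]sqrtr1 ler_sqrt ?ler1n// ltr0n.
  have /andP[D0 DnK] := DK n; move: s0 s1 st2 D0 DnK.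
  set s := Num.sqrt _; set x := D n; set x' := D n.+1; set v := u n - _.
  move=> s0 s1 st2 x0 xK; rewrite -st2.
  have -> : s / s ^+ 2 = s^-1 by field; rewrite gt_eqF.
  have -> : s ^- 2 = s^-1 * s^-1 by rewrite -invfM.
  rewrite -(addrA (B n)) -/v => h.
  rewrite -(ler_pM2l (divr_gt0 eta00 s0)).
  have si1 : s^-1 <= 1 by rewrite invf_le1.
  have si0 : 0 < s^-1 by rewrite invr_gt0.
  have h1 : K * (eta0 * s^-1) * (s^-1 + x * s^-1 + s^-1 * s^-1) <=
            K * (eta0 * s^-1) * ((K + 2) * s^-1).
    rewrite ler_wpM2l ?mulr_ge0//; try lra.
    have : x * s^-1 <= K * s^-1 by rewrite ler_wpM2r// ltW.
    have : s^-1 * s^-1 <= 1 * s^-1 by rewrite ler_wpM2r// ltW.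
    lra.
  have -> : eta0 / s * (s * (x - x') / eta0 - 2 * v + K5 / s) =
     (x - x') - 2 * (eta0 / s) * v + K * (eta0 * s^-1) * ((K + 2) * s^-1) + K * (eta0 / s) ^+ 2.
    by rewrite /K5; field; rewrite !gt_eqF.
  by lra.
pose K6 := 2 * \sum_(n < N0) B n + Num.sqrt N0%:R * D N0 / eta0 - 2 * u N0.
(* The boundary terms of the summation by parts stay on the left so that the induction closes; [K6]
   is their value at [N0]. *)
have main T : (N0 <= T)%N ->
  2 * \sum_(n < T) B n + Num.sqrt T%:R * D T / eta0 - 2 * u T <=
   K6 + (K / eta0 + 2 * K5) * Num.sqrt T%:R.
  elim: T => [|T IH].
    by rewrite leqn0 => /eqP N00; rewrite /K6 N00 sqrtr0 mulr0 addr0.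
  rewrite leq_eqVlt => /predU1P[NT|]; [|rewrite ltnS => NT].
    rewrite -NT lerDl mulr_ge0 ?sqrtr_ge0// addr_ge0 ?divr_ge0 ?mulr_ge0//; lra.
  have {IH} := IH NT; have := step T NT; rewrite big_ord_recr/=.
  have := inv_sqrt_le_sub T; have /andP[D0 DTK] := DK T.
  have : Num.sqrt T%:R <= Num.sqrt T.+1%:R :> R by rewrite ler_sqrt ?ler_nat ?ltr0n.
  have s0 : 0 < Num.sqrt T.+1%:R :> R by rewrite sqrtr_gt0 ltr0n.
  set s' := Num.sqrt T.+1%:R in s0 *; set s := Num.sqrt T%:R; set Sm := \sum_(n < T) _.
  move=> ss' hs h1 h2.
  have h3 : K5 / s' <= K5 * (2 * (s' - s)) by rewrite ler_wpM2l// ltW.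
  have h4 : (s' - s) * D T / eta0 <= (s' - s) * K / eta0.
    by rewrite ler_wpM2r ?invr_ge0 ?(ltW eta00)// ler_wpM2l// subr_ge0.
  by move: h1 h2 h3 h4; rewrite !(mulrDl, mulrDr, mulrBl, mulrBr, mulrN, mulNr) -!mulrA; lra.
pose K7 := `|K6| + K / eta0 + 2 * K5 + 2 * K.
exists K7, (maxn N0 1) => T; rewrite geq_max => /andP[NT T1].
have := main T NT; have := uK T; rewrite ler_norml => /andP[_ uT].
have /andP[D0 _] := DK T.
have s1 : 1 <= Num.sqrt T%:R :> R by rewrite -[leLHS]sqrtr1 ler_sqrt ?ler1n ?ltr0n.
set s := Num.sqrt _ in s1 *; set Sm := \sum_(n < T) _.
have : 0 <= s * D T / eta0 by rewrite divr_ge0 ?mulr_ge0//; lra.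
have : K6 <= `|K6| * s.
  by apply: (le_trans (ler_norm _)); rewrite ler_peMr.
have : 2 * u T <= 2 * K * s.
  by apply: (@le_trans _ _ (2 * K)); [lra|rewrite ler_peMr// mulr_ge0// ltW].
have z0 : 0 <= K / eta0 by rewrite divr_ge0 ?ltW.
have K70 : 0 <= K7 * s.
  apply: mulr_ge0; last lra.
  by rewrite /K7; move: (normr_ge0 K6) z0 K0 K50; clear; lra.
move: K70; rewrite /K7; move: (K / eta0) `|K6| => z k.
by rewrite !mulrDl; lra.
Qed.

(** Used to insert logarithms into bounds that lack them; it follows from [ln (1/2) <= -1/2]. *)
Lemma ln_ge_half (T : nat) : (2 <= T)%N -> 2^-1 <= ln T%:R :> R.
Proof.
move=> T2; have := @le_ln1Dx R (- 2^-1).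
have -> : 1 + - 2^-1 = 2^-1 :> R by field.
rewrite lnV ?posrE// lerN2 => /(_ _)/le_trans; apply; first lra.
by rewrite ler_ln ?posrE ?ltr0n ?ler_nat// (leq_trans _ T2).
Qed.

Lemma harmonic_sum_le (T : nat) : \sum_(n < T.+1) n.+1%:R^-1 <= 1 + ln T.+1%:R :> R.
Proof.
elim: T => [|T IH]; first by rewrite big_ord1 ln1 addr0 invr1.
rewrite big_ord_recr/= (le_trans (lerD IH (lexx _)))// -addrA lerD2l.
have T0 : 0 < T.+2%:R :> R by rewrite ltr0n.
have T1 : 0 < T.+1%:R :> R by rewrite ltr0n.
have Tn : T.+2%:R = T.+1%:R + 1 :> R by rewrite natr1.
have h : - (1 : R) < - T.+2%:R^-1 by rewrite ltrN2 invf_lt1// ltr1n.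
have := le_ln1Dx h; have -> : 1 - T.+2%:R^-1 = T.+1%:R / T.+2%:R :> R.
  by rewrite Tn; field; rewrite gt_eqF//; lra.
rewrite ln_div ?posrE//; move: (ln _) (ln _) (_^-1) => x y z; lra.
Qed.

End RealSequences.

(** * Markovian stochastic approximation *)

Section ProjectedStep.
Context {R : realType} {d : nat}.
Variables (C : set 'rV[R]_d) (p : 'rV[R]_d -> 'rV[R]_d).
Hypothesis HCconvex : convex_setv C.
Hypothesis Hp : is_eucl_proj C p.
Variables (theta thetastar g h : 'rV[R]_d) (eta G r e : R).
Hypotheses (Ctheta : C theta) (Cstar : C thetastar).
Hypotheses (eta_ge0 : 0 <= eta) (G_ge0 : 0 <= G).
Hypothesis g_le : normv g <= G.
Hypothesis h_le : normv h <= G * (e + e ^+ 2).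
Hypothesis diam_le : forall x y, C x -> C y -> normv (x - y) <= r.

Let theta' := p (theta - eta *: (g + h)).

(** The obtuse angle inequality tested at [theta] itself gives [|D|^2 <= eta <g + h, D>]. The bound
    enters linearly in the Lipschitz estimate of the Poisson corrector, so the mean of [e^2]
    suffices there. *)
Lemma projected_step_dist : normv (theta' - theta) <= 2 * eta * G * (1 + e ^+ 2).
Proof.
have := eucl_proj_obtuse (theta - eta *: (g + h)) HCconvex Hp Ctheta.
rewrite -/theta' -[theta' - theta]opprB normvN.
set D := theta - theta'.
have -> : theta - eta *: (g + h) - theta' = D - eta *: (g + h) by rewrite addrAC.
rewrite dotvBl -/(sqnormv D) -sqr_normv dotvZl => h1.
have h2 := dotv_le (g + h) D.
have h3 : normv (g + h) <= 2 * G * (1 + e ^+ 2).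
  apply: (le_trans (normvD _ _)); apply: (le_trans (lerD g_le h_le)).
  have : 0 <= G * (1 - e) ^+ 2 by rewrite mulr_ge0// sqr_ge0.
  have : 0 <= G * e ^+ 2 by rewrite mulr_ge0// sqr_ge0.
  by move: G_ge0; lra.
have D0 := normv_ge0 D; have [->|Dn] := eqVneq (normv D) 0.
  by rewrite !mulr_ge0// addr_ge0 ?sqr_ge0.
have Dp : 0 < normv D by rewrite lt_def Dn.
rewrite -(ler_pM2r Dp) -expr2.
have : eta * dotv (g + h) D <= eta * (2 * G * (1 + e ^+ 2) * normv D).
  by rewrite ler_wpM2l// (le_trans h2)// ler_wpM2r.
lra.
Qed.

(* The error [h] is only controlled by [e + e^2], whose square may have an
   infinite mean; the quadratic part of [h] is therefore paid for linearly,
   through the diameter [r], using the term [- |theta' - theta|^2] that the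
   projection provides. *)
Lemma projected_step_sqnorm :
  sqnormv (theta' - thetastar) <= sqnormv (theta - thetastar)
    - 2 * eta * dotv g (theta - thetastar)
    + 2 * eta * G * e * normv (theta - thetastar)
    + 4 * eta * G * r * e ^+ 2 + 2 * eta ^+ 2 * G ^+ 2 * (1 + e ^+ 2).
Proof.
have Ct' : C theta' by have [] := Hp (theta - eta *: (g + h)).
have nd_r := diam_le Ct' Ctheta; have nx_r := diam_le Ctheta Cstar.
have := eucl_proj_obtuse (theta - eta *: (g + h)) HCconvex Hp Cstar.
rewrite -/theta'; move: nd_r nx_r.
set D := theta' - theta; set x := theta - thetastar => nd_r nx_r.
have -> : theta - eta *: (g + h) - theta' = - (D + eta *: (g + h)).
  by rewrite opprD opprB addrAC.
have -> : thetastar - theta' = - (x + D).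
  by rewrite /x /D [theta - _ + _]addrC addrA subrK opprB.
have -> : theta' - thetastar = x + D by rewrite /x /D [in RHS]addrC addrA subrK.
clearbody D x.
rewrite dotvNl dotvNr opprK sqnormvD !dotvDl !dotvZl !dotvDl !dotvDr (dotvC D x).
rewrite -/(sqnormv D) -sqr_normv.
have := dotv_ge g D; have := dotv_ge h x; have := dotv_ge h D.
have := normv_ge0 D; have := normv_ge0 x.
move: nd_r nx_r g_le h_le (normv_ge0 g) (normv_ge0 h).
move: (normv D) (normv x) (normv g) (normv h) => nd nx ng nh.
move: (dotv g D) (dotv h x) (dotv h D) (dotv g x) (dotv x D) (sqnormv x).
move=> gD hx hD gx xD sx nd_r nx_r ng_le nh_le ng0 nh0 nx0 nd0 hD_ge hx_ge gD_ge obt.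
have e20 : 0 <= e ^+ 2 by exact: sqr_ge0.
have b1 : - gD <= G * nd by have := ler_wpM2r nd0 ng_le; lra.
have b2 : - hx <= G * e * nx + G * r * e ^+ 2.
  have h1 := ler_wpM2r nx0 nh_le.
  have : G * e ^+ 2 * nx <= G * e ^+ 2 * r by rewrite ler_wpM2l// mulr_ge0.
  lra.
have b3 : - hD <= G * e * nd + G * r * e ^+ 2.
  have h1 := ler_wpM2r nd0 nh_le.
  have : G * e ^+ 2 * nd <= G * e ^+ 2 * r by rewrite ler_wpM2l// mulr_ge0.
  lra.
have c1 := ler_wpM2l eta_ge0 b1.
have c2 := ler_wpM2l eta_ge0 b2.
have c3 := ler_wpM2l eta_ge0 b3.
(* These are Young inequalities: the cross terms [2 eta G nd] and [2 eta G e nd] each spend half of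
   the available [- nd^2]. *)
have q1 := sqr_ge0 (2 * (eta * G) - nd).
have q2 := sqr_ge0 (2 * (eta * G * e) - nd).
lra.
Qed.

End ProjectedStep.

Section StochasticApproximation.
Context {R : realType} {S A W : finType} {d : nat}.
Variables (P : S -> A -> S -> R) (Pr : S -> A -> W -> R) (b : S -> A -> R) (mu nu : S -> R).
Hypothesis HP : forall s a, is_distr (P s a).
Hypothesis HPr : forall s a, is_distr (Pr s a).
Hypothesis Hb : forall s, is_distr (b s).
Hypothesis Hmu : stationary P b mu.
Hypothesis Hirr : irreducible P b.
Context {dO : measure_display} {Omega : measurableType dO}.
Variable Pm : probability Omega R.
Variables (st : nat -> Omega -> S) (at_ : nat -> Omega -> A) (rt : nat -> Omega -> W).
Hypothesis Hst_meas : forall t x, measurable [set om | st t om = x].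
Hypothesis Hat_meas : forall t x, measurable [set om | at_ t om = x].
Hypothesis Hrt_meas : forall t x, measurable [set om | rt t om = x].
Hypothesis Hlaw : traj_law P Pr b Pm nu st at_ rt.
Variables (C : set 'rV[R]_d) (projC : 'rV[R]_d -> 'rV[R]_d) (thetastar : 'rV[R]_d).
Hypothesis HCconvex : convex_setv C.
Hypothesis HprojC : is_eucl_proj C projC.
Hypothesis Cstar : C thetastar.
Variables (r G L Ke : R) (t0 : nat).
Hypothesis diam_le : forall x y, C x -> C y -> normv (x - y) <= r.
Variables (g : 'rV[R]_d -> S -> A -> W -> S -> 'rV[R]_d) (Q : 'rV[R]_d -> S -> R).
Hypotheses (G_ge0 : 0 <= G) (L_ge0 : 0 <= L) (Ke_ge0 : 0 <= Ke).
Hypothesis g_le : forall th s a w s', C th -> normv (g th s a w s') <= G.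
Hypothesis g_mean : forall th s,
  \sum_a \sum_w \sum_s' dotv (g th s a w s') (th - thetastar) *
    (b s a * Pr s a w * P s a s') = Q th s.
Hypothesis Q_le : forall th s, C th -> `|Q th s| <= L.
Hypothesis Q_lip : forall th th' s, C th -> C th' ->
  `|Q th s - Q th' s| <= L * normv (th - th').
Variables (X : nat -> Omega -> 'rV[R]_d) (h : nat -> Omega -> 'rV[R]_d)
  (e : nat -> Omega -> R) (eta : nat -> R).
Hypothesis X_past : forall n, past_measurable st at_ rt n.+1 (X n).
Hypothesis X_C : forall n om, C (X n om).
Hypothesis X_step : forall n om, X n.+1 om =
  projC (X n om - eta n.+1 *:
    (g (X n om) (st n.+1 om) (at_ n.+1 om) (rt n.+1 om) (st n.+2 om) + h n.+1 om)).
Hypothesis h_le : forall t om, normv (h t om) <= G * (e t om + e t om ^+ 2).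
Hypothesis e_past : forall t, past_measurable st at_ rt t.+1 (e t).
Hypothesis e_sq : forall t, (t0 <= t)%N -> Ex Pm (fun om => e t om ^+ 2) <= Ke / t%:R.
Hypothesis eta_ge0 : forall t, (0 < t)%N -> 0 <= eta t.

Local Notation E := (Ex Pm).
Local Notation simple := (simple st at_ rt).
Local Notation ED := (ExD Pm Hst_meas Hat_meas Hrt_meas).
Local Notation EB := (ExB Pm Hst_meas Hat_meas Hrt_meas).
Local Notation EZ := (ExZ Pm Hst_meas Hat_meas Hrt_meas).
Local Notation E_le := (Ex_le Pm Hst_meas Hat_meas Hrt_meas).
Local Notation E_norm_le := (Ex_norm_le Pm Hst_meas Hat_meas Hrt_meas).
Local Notation E_cst := (Ex_cst Pm).

Let D n := E (fun om => sqnormv (X n om - thetastar)).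
Let B n := E (fun om => \sum_s mu s * Q (X n om) s).

(** Only the centered indicators are solved for, so that the corrector of [Q th] is the fixed linear
    combination [\sum_x Q th x * q x s] and inherits from [Q] its bound and its Lipschitz constant
    in [th]. *)
Lemma poisson_family : exists q : S -> S -> R, forall x s,
  q x s - \sum_s' Pb P b s s' * q x s' = (s == x)%:R - mu x.
Proof.
have [[_ mu1] _] := Hmu.
have ex x : exists q : S -> R, forall s,
    q s - \sum_s' Pb P b s s' * q s' = (s == x)%:R - mu x.
  apply: (poisson_equation HP Hb Hmu Hirr).
  under eq_bigr do rewrite mulrBr.
  rewrite sumrB -mulr_suml mu1 mul1r (bigD1 x)//= eqxx mulr1 big1 ?addr0 ?subrr// => s sx.
  by rewrite (negbTE sx) mulr0.
by have [q qP] := choice ex; exists q.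
Qed.

Lemma simple_X (k : 'rV[R]_d -> R) n : simple (fun om => k (X n om)).
Proof. by exists n.+1 => om om' /X_past ->. Qed.

Lemma simple_Xst (k : 'rV[R]_d -> S -> R) n m : simple (fun om => k (X n om) (st m om)).
Proof.
exists (maxn n.+1 m); apply: past_measurable_comp2.
  by apply: past_measurableW; [exact: leq_maxl|exact: X_past].
by apply: past_measurableW; [exact: leq_maxr|exact: past_measurable_st].
Qed.

Lemma simple_e2 t : simple (fun om => e t om ^+ 2).
Proof. by exists t.+1 => om om' /e_past ->. Qed.

(* [u] is the mean of the Poisson corrector: it turns the Markovian noise
   [Q (X n) (st n.+1) - \sum_s mu s * Q (X n) s] into a telescoping sum. *)
Lemma markov_noise_telescope : exists2 K, 0 <= K & exists u : nat -> R,
  (forall n, `|u n| <= K) /\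
  forall n, `|E (fun om => Q (X n om) (st n.+1 om)) - (B n + u n - u n.+1)| <=
    K * (eta n.+1 * (1 + E (fun om => e n.+1 om ^+ 2))).
Proof.
have [q qP] := poisson_family.
pose U th s := \sum_x Q th x * q x s.
pose Lq := L * \sum_x \sum_s `|q x s|.
have qsum s : \sum_x `|q x s| <= \sum_x \sum_s `|q x s|.
  by apply: ler_sum => x _; rewrite (bigD1 s)//= lerDl sumr_ge0.
have Lq0 : 0 <= Lq by rewrite mulr_ge0//; apply: sumr_ge0 => x _; exact: sumr_ge0.
have U_le th s : C th -> `|U th s| <= Lq.
  move=> Cth; apply: (le_trans (ler_norm_sum _ _ _)).
  apply: (@le_trans _ _ (L * \sum_x `|q x s|)); last by rewrite ler_wpM2l.
  by rewrite mulr_sumr; apply: ler_sum => x _; rewrite normrM ler_wpM2r// Q_le.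
have U_lip th th' s : C th -> C th' -> `|U th s - U th' s| <= Lq * normv (th - th').
  move=> Cth Cth'; rewrite /U -sumrB; apply: (le_trans (ler_norm_sum _ _ _)).
  apply: (@le_trans _ _ (L * normv (th - th') * \sum_x `|q x s|)); last first.
    by rewrite /Lq mulrAC ler_wpM2r ?normv_ge0// ler_wpM2l.
  by rewrite mulr_sumr; apply: ler_sum => x _; rewrite -mulrBl normrM ler_wpM2r// Q_lip.
have U_poisson th s :
    Q th s = \sum_x mu x * Q th x + U th s - \sum_s' Pb P b s s' * U th s'.
  rewrite /U; under [X in _ - X]eq_bigr do rewrite mulr_sumr.
  rewrite exchange_big/= -addrA -sumrB.
  under [X in _ + X]eq_bigr => x _.
    under eq_bigr do rewrite mulrCA.
    rewrite -mulr_sumr -mulrBr qP mulrBr [Q th x * mu x]mulrC; over.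
  rewrite sumrB addrC subrK (bigD1 s)//= eqxx mulr1 big1 ?addr0// => x xs.
  by rewrite eq_sym (negbTE xs) mulr0.
pose u n := E (fun om => U (X n om) (st n.+1 om)).
(* [X n] is already determined by the history up to [st n.+1], so [st n.+2] can be integrated
   out. *)
have EU n : E (fun om => U (X n om) (st n.+2 om)) =
    E (fun om => \sum_s' Pb P b (st n.+1 om) s' * U (X n om) s').
  have := @markov _ _ _ _ _ _ Pm _ _ _ Hst_meas Hat_meas Hrt_meas _ _ _ _ Hlaw n.+1
    (fun om _ _ s' => U (X n om) s').
  move=> /= ->; last by move=> _ _ s' om om' /X_past ->.
  congr Ex; apply/funext => om; set s := st n.+1 om.
  under [RHS]eq_bigr do rewrite /Pb mulr_suml.
  rewrite [RHS]exchange_big/=; apply: eq_bigr => a _.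
  rewrite exchange_big/=; apply: eq_bigr => s' _.
  rewrite -mulr_sumr mulrC; congr (_ * _).
  by rewrite -mulr_suml -mulr_sumr (proj2 (HPr s a)) mulr1.
have GLq0 : 0 <= 2 * G * Lq by apply: mulr_ge0 => //; apply: mulr_ge0.
exists (2 * G * Lq + Lq); first exact: addr_ge0.
exists u; split=> [n|n].
  apply: (@le_trans _ _ Lq); last by rewrite lerDr.
  rewrite -[leRHS]E_cst; apply: E_norm_le => [| |om]; [exact: simple_Xst|exact: simple_cst|exact: U_le].
have -> : E (fun om => Q (X n om) (st n.+1 om)) =
    B n + u n - E (fun om => U (X n om) (st n.+2 om)).
  rewrite EU /B /u -ED -?EB.
  - by congr Ex; apply/funext => om; rewrite U_poisson.
  - exact: (simpleD (simple_X (fun th => \sum_s mu s * Q th s) n) (simple_Xst U n n.+1)).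
  - exact: (simple_Xst (fun th s => \sum_s' Pb P b s s' * U th s') n n.+1).
  - exact: (simple_X (fun th => \sum_s mu s * Q th s) n).
  - exact: (simple_Xst U n n.+1).
(* What remains compares the corrector at two successive iterates in the same state [st n.+2], a
   difference of the order of the step size. *)
rewrite (_ : _ - _ = u n.+1 - E (fun om => U (X n om) (st n.+2 om))); last by ring.
rewrite /u -EB; [|exact: simple_Xst|exact: simple_Xst].
have e2s := simple_e2 n.+1.
have s1 := simpleD (simple_cst st at_ rt 1) e2s.
have s2 := simpleZ (eta n.+1) s1.
rewrite -[X in _ * (_ * (X + _))]E_cst -(ED (simple_cst st at_ rt 1) e2s) -(EZ _ s1) -(EZ _ s2).
apply: E_norm_le => [||om].
- exact: simpleB (simple_Xst U n.+1 n.+2) (simple_Xst U n n.+2).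
- exact: simpleZ.
apply: (le_trans (U_lip _ _ _ (X_C _ _) (X_C _ _))); rewrite X_step.
have := projected_step_dist HCconvex HprojC (X_C n om) (eta_ge0 (ltn0Sn n)) G_ge0
  (g_le (st n.+1 om) (at_ n.+1 om) (rt n.+1 om) (st n.+2 om) (X_C n om)) (h_le n.+1 om).
move/(ler_wpM2l Lq0)/le_trans; apply; set y := _ + e _ _ ^+ 2.
have y0 : 0 <= y by rewrite addr_ge0 ?sqr_ge0.
rewrite (_ : Lq * _ = 2 * G * Lq * (eta n.+1 * y)); last by ring.
by rewrite ler_wpM2r ?mulr_ge0 ?eta_ge0// lerDl.
Qed.

(** The weight [kappa] is quantified inside, after [K] and [u], so that each rate can choose it,
    even differently at each step. *)
Lemma stochastic_recursion : exists (K : R) (N0 : nat) (u : nat -> R),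
  [/\ 0 < K, forall n, `|u n| <= K, forall n, 0 <= D n <= K, forall n, B n <= K &
   forall n kappa, (N0 <= n)%N -> 0 < kappa ->
    D n.+1 <= D n - 2 * eta n.+1 * (B n + u n - u n.+1)
      + K * eta n.+1 * (kappa / n.+1%:R + D n / kappa + n.+1%:R^-1)
      + K * eta n.+1 ^+ 2].
Proof.
have [Ku Ku0 [u [u_le uP]]] := markov_noise_telescope.
have r0 : 0 <= r by have := diam_le Cstar Cstar; exact/le_trans/normv_ge0.
have [[mu0 mu1] _] := Hmu.
have G0 := G_ge0; have L0 := L_ge0; have Ke0 := Ke_ge0.
pose K := Ku + r ^+ 2 + L + G * Ke + G + 4 * G * r * Ke
          + (2 * G ^+ 2 * (1 + Ke) + 2 * Ku * (1 + Ke)) + 1.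
have k1 : 0 <= G * Ke by rewrite mulr_ge0.
have k2 : 0 <= 4 * G * r * Ke by rewrite !mulr_ge0.
have k3 : 0 <= 2 * G ^+ 2 * (1 + Ke) + 2 * Ku * (1 + Ke).
  by rewrite addr_ge0 ?mulr_ge0 ?sqr_ge0 ?addr_ge0.
have k4 : 0 <= r ^+ 2 by exact: sqr_ge0.
have sD n : simple (fun om => sqnormv (X n om - thetastar)).
  exact: (simple_X (fun th => sqnormv (th - thetastar))).
exists K, t0, u; split.
- by rewrite /K; lra.
- by move=> n; apply: (le_trans (u_le n)); rewrite /K; lra.
- move=> n; apply/andP; split.
    rewrite -(E_cst 0); apply: E_le => // [|om]; [exact: simple_cst|exact: sqnormv_ge0].
  apply: (@le_trans _ _ (r ^+ 2)); last by rewrite /K; lra.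
  rewrite -(E_cst (r ^+ 2)); apply: E_le => // [|om]; first exact: simple_cst.
  by rewrite -sqr_normv ler_pXn2r ?nnegrE ?normv_ge0// diam_le.
- move=> n; apply: (@le_trans _ _ L); last by rewrite /K; lra.
  rewrite -(E_cst L); apply: E_le => // [||om].
  + exact: (simple_X (fun th => \sum_s mu s * Q th s)).
  + exact: simple_cst.
  rewrite -[leRHS]mul1r -mu1 mulr_suml; apply: ler_sum => s _.
  by rewrite ler_wpM2l// (le_trans (ler_norm _))// Q_le.
move=> n kappa nt0 kappa0.
set et := eta n.+1; have et0 : 0 <= et by exact: eta_ge0.
set gx := fun om => dotv (g (X n om) (st n.+1 om) (at_ n.+1 om) (rt n.+1 om) (st n.+2 om))
  (X n om - thetastar).
have gx_past : past_measurable st at_ rt n.+2 gx.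
  move=> om om' hp; have hp' := same_pastW (leqnSn _) hp.
  rewrite /gx (X_past hp') (proj2 hp'); have [_ -> ->] := proj1 hp n.+1 (ltnSn _).
  by rewrite (proj2 hp).
have gxs : simple gx by exists n.+2.
have Egx : E gx = E (fun om => Q (X n om) (st n.+1 om)).
  have := @markov _ _ _ _ _ _ Pm _ _ _ Hst_meas Hat_meas Hrt_meas _ _ _ _ Hlaw n.+1
    (fun om a w s' => dotv (g (X n om) (st n.+1 om) a w s') (X n om - thetastar)).
  move=> /= ->; last first.
    by move=> a w s' om om' hp; rewrite (X_past hp) (proj2 hp).
  by congr Ex; apply/funext => om; rewrite g_mean.
pose c1 := et * G * kappa + 4 * et * G * r + 2 * et ^+ 2 * G ^+ 2.
have e2s := simple_e2 n.+1.
have pw om : sqnormv (X n.+1 om - thetastar) <=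
    (1 + et * G / kappa) * sqnormv (X n om - thetastar) + ((- (2 * et)) * gx om
     + (c1 * e n.+1 om ^+ 2 + 2 * et ^+ 2 * G ^+ 2)).
  rewrite X_step; have := projected_step_sqnorm HCconvex HprojC (X_C n om) Cstar
    (eta_ge0 (ltn0Sn n)) G_ge0
    (g_le (st n.+1 om) (at_ n.+1 om) (rt n.+1 om) (st n.+2 om) (X_C n om))
    (h_le n.+1 om) diam_le.
  rewrite -/et -/(gx om) -(sqr_normv (X n om - _)) /c1; move: (normv (X n om - _)) (gx om) (e n.+1 om).
  move=> x y z; move/le_trans; apply.
  (* The only term mixing [e] with the distance is split here, leaving the square of the error and a
     multiple of the squared distance. *)
  have amgm : 2 * z * x <= kappa * z ^+ 2 + x ^+ 2 / kappa.
    rewrite -subr_ge0 (_ : _ - _ = (kappa * z - x) ^+ 2 / kappa).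
      by rewrite divr_ge0 ?sqr_ge0// ltW.
    by field; rewrite gt_eqF.
  have := ler_wpM2l (mulr_ge0 et0 G_ge0) amgm.
  move: (kappa^-1) => j; lra.
have {pw} : D n.+1 <= (1 + et * G / kappa) * D n + ((- (2 * et)) * E gx
     + (c1 * E (fun om => e n.+1 om ^+ 2) + 2 * et ^+ 2 * G ^+ 2)).
  rewrite /D -[X in _ + (_ + (_ + X))]E_cst.
  have s1 := simpleZ (1 + et * G / kappa) (sD n).
  have s2 := simpleZ (- (2 * et)) gxs.
  have s3 := simpleZ c1 e2s.
  have s4 := simple_cst st at_ rt (2 * et ^+ 2 * G ^+ 2).
  have s5 := simpleD s3 s4.
  have s6 := simpleD s2 s5.
  rewrite -(EZ _ (sD n)) -(EZ _ gxs) -(EZ _ e2s) -(ED s3 s4) -(ED s2 s5) -(ED s1 s6).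
  by apply: E_le => //; exact: simpleD.
rewrite Egx; have Ee := e_sq (leqW nt0); have := uP n; rewrite -/et ler_norml => /andP[uPn _].
have t1 : n.+1%:R^-1 <= 1 :> R by rewrite invf_le1 ?ler1n ?ltr0n.
have ti0 : 0 <= n.+1%:R^-1 :> R by rewrite invr_ge0.
have Ee0 : 0 <= E (fun om => e n.+1 om ^+ 2).
  by rewrite -(E_cst 0); apply: E_le => // [|om]; [exact: simple_cst|exact: sqr_ge0].
have Dn0 : 0 <= D n.
  by rewrite -(E_cst 0); apply: E_le => // [|om]; [exact: simple_cst|exact: sqnormv_ge0].
move: uPn t1 ti0 Ee Ee0 Dn0; rewrite -/et.
move: (E (fun om => e n.+1 om ^+ 2)) (E (fun om => Q _ _)) (D n) (D n.+1) (B n) (u n) (u n.+1).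
move: n.+1%:R^-1 => i; move=> E2 EQ x x' y v v' uPn i1 i0 Ee Ee0 x0 Dle.
have Ke2 : Ke * i <= Ke by rewrite ler_piMr.
have w1 : 2 * et * (y + v - v' - EQ) <= 2 * Ku * (1 + Ke) * et ^+ 2.
  have : y + v - v' - EQ <= Ku * (1 + Ke) * et.
    have : Ku * (et * (1 + E2)) <= Ku * (et * (1 + Ke)) by rewrite !ler_wpM2l//; lra.
    lra.
  by move/(ler_wpM2l (mulr_ge0 (ler0n R 2) et0)); lra.
have w2 : et * G * kappa * E2 <= (G * Ke) * (et * (kappa * i)).
  rewrite (_ : _ * (_ * (_ * _)) = et * G * kappa * (Ke * i)); last by ring.
  by rewrite ler_wpM2l// !mulr_ge0// ltW.
have w3 : 4 * et * G * r * E2 <= (4 * G * r * Ke) * (et * i).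
  rewrite (_ : _ * (et * _) = 4 * et * G * r * (Ke * i)); last by ring.
  by rewrite ler_wpM2l// !mulr_ge0.
have w4 : 2 * et ^+ 2 * G ^+ 2 * (1 + E2) <= (2 * G ^+ 2 * (1 + Ke)) * et ^+ 2.
  rewrite (_ : _ * (_ + Ke) * _ = 2 * et ^+ 2 * G ^+ 2 * (1 + Ke)); last by ring.
  by rewrite ler_wpM2l ?mulr_ge0 ?sqr_ge0//; lra.
have a1 : (G * Ke) * (et * (kappa * i)) <= K * (et * (kappa * i)).
  by rewrite ler_wpM2r ?mulr_ge0 ?(ltW kappa0)// /K; lra.
have a2 : (4 * G * r * Ke) * (et * i) <= K * (et * i).
  by rewrite ler_wpM2r ?mulr_ge0// /K; lra.
have a3 : (2 * G ^+ 2 * (1 + Ke) + 2 * Ku * (1 + Ke)) * et ^+ 2 <= K * et ^+ 2.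
  by rewrite ler_wpM2r ?sqr_ge0// /K; lra.
have a4 : G * (et * (x / kappa)) <= K * (et * (x / kappa)).
  have xk : 0 <= x / kappa by rewrite divr_ge0// ltW.
  by rewrite (ler_wpM2r (mulr_ge0 et0 xk))// /K; lra.
move: a1 a2 a3 a4 Dle w1 w2 w3 w4; rewrite /c1; move: K => {}K.
move: (kappa^-1) => j; lra.
Qed.

End StochasticApproximation.

(** * The three update directions *)

Section UpdateDirections.
Context {R : realType} {S A W : finType} {d : nat}.
Variables (P : S -> A -> S -> R) (Pr : S -> A -> W -> R) (rv : W -> R)
  (gamma : R) (pi b : S -> A -> R) (mu : S -> R)
  (phi : S -> 'rV[R]_d) (zeta : 'rV[R]_d).
Hypothesis HP : forall s a, is_distr (P s a).
Hypothesis HPr : forall s a, is_distr (Pr s a).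
Hypothesis Hpi : forall s, is_distr (pi s).
Variable Cratio : R.
Hypothesis Hratio : forall s a, pi s a <= Cratio * mu s * b s a.

Lemma ppi_distr s : is_distr (ppi P pi s).
Proof.
split=> [s'|].
  by apply: sumr_ge0 => a _; apply: mulr_ge0; [have [] := Hpi s|have [] := HP s a].
rewrite exchange_big/= -[RHS](proj2 (Hpi s)); apply: eq_bigr => a _.
by rewrite -mulr_sumr (proj2 (HP s a)) mulr1.
Qed.

Lemma rpi_distr s : is_distr (rpi Pr pi s).
Proof.
split=> [w|].
  by apply: sumr_ge0 => a _; apply: mulr_ge0; [have [] := Hpi s|have [] := HPr s a].
rewrite exchange_big/= -[RHS](proj2 (Hpi s)); apply: eq_bigr => a _.
by rewrite -mulr_sumr (proj2 (HPr s a)) mulr1.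
Qed.

(** Where [b s a = 0] the quotient is 0 by convention, and [Hratio] forces [pi s a = 0] as well. *)
Lemma importance_weight s a : b s a * (pi s a / b s a) = pi s a.
Proof.
have [b0|b0] := eqVneq (b s a) 0; last by rewrite mulrCA divff ?mulr1.
rewrite b0 mul0r; apply/eqP; rewrite eq_le (proj1 (Hpi s)) /=.
by have := Hratio s a; rewrite b0 mulr0.
Qed.

(** Reward and next state enter the sampled factor additively, so each part sees only its own
    marginal, which the weight turns from [b] to [pi]. *)
Lemma importance_mean s (k1 : W -> R) (k2 : S -> R) :
  \sum_a \sum_w \sum_s' (pi s a / b s a * (k1 w + k2 s')) *
    (b s a * Pr s a w * P s a s') =
  \sum_w rpi Pr pi s w * k1 w + \sum_s' ppi P pi s s' * k2 s'.
Proof.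
transitivity (\sum_a pi s a * (\sum_w Pr s a w * k1 w + \sum_s' P s a s' * k2 s')).
  apply: eq_bigr => a _.
  under eq_bigr => w _.
    under eq_bigr => s' _.
      rewrite (_ : _ * _ = pi s a * (Pr s a w * k1 w * P s a s' + Pr s a w * (P s a s' * k2 s'))).
      over.
      by rewrite -[in RHS](importance_weight s a); ring.
    rewrite -mulr_sumr big_split/= -mulr_sumr -mulr_sumr (proj2 (HP s a)) mulr1; over.
  by rewrite -mulr_sumr big_split/= -mulr_suml (proj2 (HPr s a)) mul1r.
under eq_bigr do rewrite mulrDr !mulr_sumr.
rewrite big_split/=; congr (_ + _); rewrite exchange_big/=; apply: eq_bigr => x _;
  by rewrite mulr_suml; apply: eq_bigr => a _; rewrite mulrA.
Qed.

Lemma distr_step_mean s (Hb : is_distr (b s)) (k : R) :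
  \sum_a \sum_w \sum_s' k * (b s a * Pr s a w * P s a s') = k.
Proof.
rewrite -[RHS]mulr1 -(proj2 Hb) mulr_sumr; apply: eq_bigr => a _.
under eq_bigr do rewrite -mulr_sumr -mulr_sumr (proj2 (HP s a)) mulr1.
by rewrite -mulr_sumr -mulr_sumr (proj2 (HPr s a)) mulr1.
Qed.

Definition td_dir s : 'rV[R]_d := dir_of gamma phi zeta (phipi P pi phi s) s.

Lemma td_dir_mean s x :
  \sum_s' ppi P pi s s' * dotv (- zeta + gamma *: phi s' - phi s) x = dotv (td_dir s) x.
Proof.
rewrite /td_dir /dir_of /phipi /phi_of !dotvDl dotvZl dotv_suml !dotvNl.
under eq_bigr do rewrite !dotvDl dotvZl !dotvNl !mulrDr mulrCA.
rewrite !big_split/= -!mulr_suml (proj2 (ppi_distr s)) !mul1r -mulr_sumr.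
by congr (_ + _ * _ + _); apply: eq_bigr => s' _; rewrite dotvZl.
Qed.

Definition update_dir (al : alg) (prh : W -> R) (psh : S -> R) (muh : R)
    (th : 'rV[R]_d) (s : S) (a : A) (w : W) (s' : S) : 'rV[R]_d :=
  match al with
  | DirectSGD => ghat_direct rv gamma phi zeta prh psh th s
  | TDSGD => ghat_tdsgd rv gamma pi b phi zeta prh psh th s a s'
  | TD0 => ghat_td0 gamma pi b phi zeta muh th s a (rv w) s'
  end.

Definition true_dir al th s a w s' :=
  update_dir al (rpi Pr pi s) (ppi P pi s) (mu s) th s a w s'.

(** The second linear form of the mean drift. For TD(0) its factor [1 / mu s] cancels against the
    averaging by [mu], which is how [gbar_td0] arises. *)
Definition mean_dir (al : alg) s : 'rV[R]_d :=
  if al is TD0 then - (mu s)^-1 *: (phi s + zeta) else td_dir s.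

Variable thetastar : 'rV[R]_d.
Hypothesis Hthetastar : forall s, delta P Pr rv gamma pi phi zeta thetastar s = 0.

Lemma delta_dotv th s :
  delta P Pr rv gamma pi phi zeta th s = dotv (td_dir s) (th - thetastar).
Proof.
rewrite dotvBr -[LHS]subr0 -(Hthetastar s) /delta /delta_of -/(td_dir s).
ring.
Qed.

Definition Qdir al th s : R :=
  dotv (td_dir s) (th - thetastar) * dotv (mean_dir al s) (th - thetastar).

(** At most one factor of each direction is sampled: none for direct-SGD, the feature difference for
    TD-SGD, the temporal difference for TD(0). The mean of the product is thus the product of the
    means. *)
Lemma true_dir_mean al th s : is_distr (b s) ->
  \sum_a \sum_w \sum_s' dotv (true_dir al th s a w s') (th - thetastar) *
    (b s a * Pr s a w * P s a s') = Qdir al th s.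
Proof.
move=> Hb; rewrite /Qdir; case: al => /=.
- rewrite /ghat_direct distr_step_mean//.
  by rewrite dotvZl -/(delta P Pr rv gamma pi phi zeta th s) delta_dotv.
- set x := th - thetastar.
  pose k2 s' := delta P Pr rv gamma pi phi zeta th s * dotv (- zeta + gamma *: phi s' - phi s) x.
  have := importance_mean s (fun=> 0) k2.
  under [X in _ = X + _]eq_bigr do rewrite mulr0.
  rewrite [X in _ = X + _]big1// add0r /k2; under [X in _ = X]eq_bigr do rewrite mulrCA.
  rewrite -mulr_sumr td_dir_mean delta_dotv => <-.
  apply: eq_bigr => a _; apply: eq_bigr => w _; apply: eq_bigr => s' _.
  rewrite add0r -delta_dotv; congr (_ * _).
  by rewrite /true_dir /update_dir /ghat_tdsgd dotvZl -mulrA.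
- set x := th - thetastar; set F := dotv (phi s + zeta) x.
  pose k1 w := - (mu s)^-1 * F * rv w.
  pose k2 s' := - (mu s)^-1 * F * dotv (- zeta + gamma *: phi s' - phi s) th.
  transitivity (\sum_w rpi Pr pi s w * k1 w + \sum_s' ppi P pi s s' * k2 s').
    rewrite -importance_mean.
    apply: eq_bigr => a _; apply: eq_bigr => w _; apply: eq_bigr => s' _; congr (_ * _).
    rewrite /true_dir /update_dir /ghat_td0 dotvZl -/F /k1 /k2 !dotvDl !dotvNl dotvZl; ring.
  rewrite /k1 /k2; under eq_bigr do rewrite mulrCA.
  under [X in _ + X]eq_bigr do rewrite mulrCA.
  rewrite -!mulr_sumr -mulrDr td_dir_mean dotvZl -/F -delta_dotv mulrC.
  by rewrite /delta /delta_of.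
Qed.

Lemma Qdir_loss al : al = DirectSGD \/ al = TDSGD -> forall th,
  \sum_s mu s * Qdir al th s = 2 * loss P Pr rv gamma pi mu phi zeta th.
Proof.
move=> hal th; rewrite /loss mulr_sumr; apply: eq_bigr => s _.
rewrite delta_dotv /Qdir (_ : mean_dir al s = td_dir s); last by case: hal => ->.
by field.
Qed.

Lemma Qdir_td0 th : (forall s, 0 < mu s) -> \sum_s mu s * Qdir TD0 th s =
  dotv (th - thetastar) (gbar_td0 P Pr rv gamma pi phi zeta th).
Proof.
move=> mu0; rewrite dotvC /gbar_td0 dotvNl dotv_suml -sumrN; apply: eq_bigr => s _.
rewrite dotvZl delta_dotv /Qdir /= dotvZl; field.
by rewrite gt_eqF.
Qed.

Variables (M : R).
Hypotheses (M1 : 1 <= M) (Hgamma : 0 < gamma <= 1).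
Hypothesis phi_M : forall s, normv (phi s) <= M.
Hypothesis zeta_M : normv zeta <= M.
Hypothesis rv_M : forall w, `|rv w| <= M.
Hypothesis ratio_M : forall s a, `|pi s a / b s a| <= M.
Hypothesis muV_M : forall s, `|(mu s)^-1| <= M.

Let M0 : 0 <= M. Proof. exact: le_trans ler01 M1. Qed.

(** One bound [M >= 1] serves for all data, so every product of norms is raised to the common power
    [M ^+ 5] and the three algorithms share their constants. *)
Lemma expM_le (m n : nat) (k : R) : 0 <= k -> (m <= n)%N -> k * M ^+ m <= k * M ^+ n.
Proof. by move=> k0 mn; rewrite ler_wpM2l// ler_weXn2l. Qed.

Lemma normv_wsum_le (p : S -> R) : normv (phi_of phi p) <= M * \sum_s `|p s|.
Proof.
apply: (le_trans (normv_sum _ _ _)); rewrite mulr_sumr; apply: ler_sum => s _.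
by rewrite normvZ mulrC ler_wpM2r.
Qed.

Lemma phi_ofB (p q : S -> R) : phi_of phi p - phi_of phi q = phi_of phi (fun s => p s - q s).
Proof. by rewrite /phi_of -sumrB; apply: eq_bigr => s _; rewrite scalerBl. Qed.

Lemma distr_sum_norm {T : finType} (p : T -> R) : is_distr p -> \sum_x `|p x| = 1.
Proof. by move=> [p0 <-]; apply: eq_bigr => x _; rewrite ger0_norm. Qed.

Lemma normv_dir_le (ph : 'rV[R]_d) s B : normv ph <= B ->
  normv (- zeta + gamma *: ph - phi s) <= 2 * M + B.
Proof.
move=> phB; have [g0 g1] := andP Hgamma.
have h1 : normv (gamma *: ph) <= B.
  by rewrite normvZ gtr0_norm// (le_trans _ phB)// ler_piMl ?normv_ge0.
have h2 := normvB (- zeta + gamma *: ph) (phi s).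
have h3 := normvD (- zeta) (gamma *: ph); have h4 := phi_M s; have h5 := zeta_M.
by move: h3; rewrite normvN; lra.
Qed.

Lemma normv_td_dir s : normv (td_dir s) <= 3 * M.
Proof.
have h := normv_wsum_le (ppi P pi s); rewrite (distr_sum_norm (ppi_distr s)) mulr1 in h.
by apply: (le_trans (normv_dir_le s h)); lra.
Qed.

Lemma normv_mean_dir al s : normv (mean_dir al s) <= 3 * M ^+ 2.
Proof.
have h : 3 * M <= 3 * M ^+ 2 by apply: (@expM_le 1 2).
case: al => /=; try exact: le_trans (normv_td_dir s) h.
rewrite normvZ normrN; have h1 := normvD (phi s) zeta.
have h2 := phi_M s; have h3 := zeta_M; have h4 := muV_M s; have M0' := M0.
apply: (@le_trans _ _ (M * (2 * M))); first by rewrite ler_pM ?normv_ge0//; lra.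
by rewrite -subr_ge0 (_ : _ - _ = M ^+ 2) ?sqr_ge0//; ring.
Qed.

Lemma norm_delta_le th s : normv th <= M ->
  `|delta P Pr rv gamma pi phi zeta th s| <= 4 * M ^+ 2.
Proof.
move=> thM; apply: (le_trans (ler_normD _ _)).
have h1 : `|xipi Pr rv pi s| <= M.
  apply: (le_trans (ler_norm_sum _ _ _)); rewrite -[leRHS]mul1r -(distr_sum_norm (rpi_distr s)).
  by rewrite mulr_suml; apply: ler_sum => w _; rewrite normrM ler_wpM2l.
have h2 := cauchy_schwarz (td_dir s) th.
have h3 : normv (td_dir s) * normv th <= 3 * M * M.
  by rewrite ler_pM ?normv_ge0// normv_td_dir.
have h4 : 1 * M ^+ 1 <= 1 * M ^+ 2 by exact: expM_le.
by move: h2; rewrite /td_dir; lra.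
Qed.

Lemma norm_td_le w s s' th : normv th <= M ->
  `|rv w - dotv zeta th + gamma * dotv (phi s') th - dotv (phi s) th| <= 4 * M ^+ 2.
Proof.
move=> thM.
rewrite (_ : _ - _ = rv w + dotv (- zeta + gamma *: phi s' - phi s) th); last first.
  by rewrite !dotvDl dotvZl !dotvNl; ring.
apply: (le_trans (ler_normD _ _)); have h1 := rv_M w.
have h2 := cauchy_schwarz (- zeta + gamma *: phi s' - phi s) th.
have h3 : normv (- zeta + gamma *: phi s' - phi s) * normv th <= 3 * M * M.
  rewrite ler_pM ?normv_ge0//; have := normv_dir_le s (phi_M s'); lra.
have h4 : 1 * M ^+ 1 <= 1 * M ^+ 2 by exact: expM_le.
lra.
Qed.

Lemma normv_true_dir al th s a w s' : normv th <= M ->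
  normv (true_dir al th s a w s') <= 12 * M ^+ 5.
Proof.
move=> thM; have dM := norm_delta_le s thM; have M0' := M0.
have M2 : 0 <= 4 * M ^+ 2 by rewrite mulr_ge0 ?sqr_ge0.
case: al; rewrite /true_dir/=.
- rewrite /ghat_direct normvZ; apply: (@le_trans _ _ (4 * M ^+ 2 * (3 * M))).
    by rewrite ler_pM ?normv_ge0// normv_td_dir.
  rewrite (_ : _ * (3 * _) = 12 * M ^+ 3); last by ring.
  exact: expM_le.
- rewrite /ghat_tdsgd normvZ normrM; apply: (@le_trans _ _ (M * (4 * M ^+ 2) * (3 * M))).
    rewrite ler_pM ?normv_ge0 ?mulr_ge0//; first by rewrite ler_pM.
    by have := normv_dir_le s (phi_M s'); lra.
  rewrite (_ : _ * (3 * _) = 12 * M ^+ 4); last by ring.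
  exact: expM_le.
- rewrite /ghat_td0 normvZ normrN !normrM.
  apply: (@le_trans _ _ (M * M * (4 * M ^+ 2) * (2 * M))).
    have h1 : normv (phi s + zeta) <= 2 * M.
      by apply: (le_trans (normvD _ _)); have := phi_M s; have := zeta_M; lra.
    rewrite ler_pM ?normv_ge0 ?mulr_ge0// ler_pM ?mulr_ge0 ?norm_td_le//.
    by rewrite ler_pM ?mulr_ge0 ?muV_M// -normrM ratio_M.
  rewrite (_ : _ * (2 * _) = 8 * M ^+ 5); last by ring.
  by rewrite ler_wpM2r ?exprn_ge0// ler_nat.
Qed.

(** In direct-SGD both factors are estimated, whence the term in [e ^+ 2]; the other two directions
    contain a single estimated factor and have an error linear in [e]. *)
Lemma normv_update_dir_err al prh psh muh th s a w s' (e : R) : normv th <= M ->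
  \sum_w `|prh w - rpi Pr pi s w| <= e ->
  \sum_s' `|psh s' - ppi P pi s s'| <= e ->
  `|muh^-1 - (mu s)^-1| <= e ->
  normv (update_dir al prh psh muh th s a w s' - true_dir al th s a w s') <=
    12 * M ^+ 5 * (e + e ^+ 2).
Proof.
move=> thM he1 he2 he3; have M0' := M0.
have e0 : 0 <= e by exact: le_trans he3.
have e20 : 0 <= e ^+ 2 by exact: sqr_ge0.
have dM := norm_delta_le s thM.
pose dh := delta_of gamma phi zeta (xi_of rv prh) (phi_of phi psh) th s.
pose dirh := dir_of gamma phi zeta (phi_of phi psh) s.
have [g0 g1] := andP Hgamma.
have dirhE : dirh - td_dir s = gamma *: phi_of phi (fun s' => psh s' - ppi P pi s s').
  rewrite /dirh /td_dir /dir_of -phi_ofB scalerBr.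
  by apply/rowP => i; rewrite !mxE; ring.
have dir_err : normv (dirh - td_dir s) <= M * e.
  rewrite dirhE normvZ gtr0_norm// (le_trans (ler_piMl (normv_ge0 _) g1))//.
  by apply: (le_trans (normv_wsum_le _)); rewrite ler_wpM2l.
have xi_err : `|xi_of rv prh - xipi Pr rv pi s| <= M * e.
  rewrite /xipi /xi_of -sumrB (le_trans (ler_norm_sum _ _ _))//.
  apply: (le_trans _ (ler_wpM2l M0 he1)); rewrite mulr_sumr; apply: ler_sum => x _.
  by rewrite -mulrBl normrM mulrC ler_wpM2r.
have d_err : `|dh - delta P Pr rv gamma pi phi zeta th s| <= 2 * M ^+ 2 * e.
  rewrite (_ : dh - _ = (xi_of rv prh - xipi Pr rv pi s) + dotv (dirh - td_dir s) th); last first.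
    by rewrite dotvBl /dh /delta /delta_of -/(td_dir s) -/dirh; ring.
  apply: (le_trans (ler_normD _ _)); have h1 := cauchy_schwarz (dirh - td_dir s) th.
  have h2 : normv (dirh - td_dir s) * normv th <= M * e * M by rewrite ler_pM ?normv_ge0.
  have h3 : M ^+ 1 * e <= M ^+ 2 * e by rewrite ler_wpM2r// ler_weXn2l.
  lra.
have p3 : 0 <= 4 * M ^+ 2 by rewrite mulr_ge0 ?sqr_ge0.
have q2 : 0 <= 2 * M ^+ 2 * e by rewrite !mulr_ge0 ?sqr_ge0.
case: al; rewrite /true_dir/=.
- rewrite /ghat_direct -/dh -/dirh -/(delta P Pr rv gamma pi phi zeta th s) -/(td_dir s).
  set dt := delta _ _ _ _ _ _ _ _ _ in dM d_err *.
  rewrite (_ : _ - _ = (dh - dt) *: (dirh - td_dir s) + (dh - dt) *: td_dir s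
                      + dt *: (dirh - td_dir s)); last first.
    clear; move: (dirh) (td_dir s) => u v.
    by rewrite -scalerDr subrK; apply/rowP => i; rewrite !mxE; ring.
  apply: (le_trans (normvD _ _)); apply: (le_trans (lerD (normvD _ _) (lexx _))).
  rewrite !normvZ.
  have h1 : `|dh - dt| * normv (dirh - td_dir s) <= 2 * M ^+ 2 * e * (M * e).
    by rewrite ler_pM ?normv_ge0.
  have h2 : `|dh - dt| * normv (td_dir s) <= 2 * M ^+ 2 * e * (3 * M).
    by rewrite ler_pM ?normv_ge0// normv_td_dir.
  have h3 : `|dt| * normv (dirh - td_dir s) <= 4 * M ^+ 2 * (M * e).
    by rewrite ler_pM ?normv_ge0.
  have h4 : 12 * M ^+ 3 * (e + e ^+ 2) <= 12 * M ^+ 5 * (e + e ^+ 2).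
    by rewrite ler_wpM2r ?addr_ge0//; exact: expM_le.
  have h5 : 0 <= M ^+ 3 * e by rewrite mulr_ge0 ?exprn_ge0.
  have h6 : 0 <= M ^+ 3 * e ^+ 2 by rewrite mulr_ge0 ?exprn_ge0.
  lra.
- rewrite /ghat_tdsgd -/dh -/(delta P Pr rv gamma pi phi zeta th s) -scalerBl -mulrBr normvZ normrM.
  apply: (@le_trans _ _ (M * (2 * M ^+ 2 * e) * (3 * M))).
    rewrite ler_pM ?normv_ge0 ?mulr_ge0//; first by rewrite ler_pM.
    by have := normv_dir_le s (phi_M s'); lra.
  have h4 : 12 * M ^+ 4 * (e + e ^+ 2) <= 12 * M ^+ 5 * (e + e ^+ 2).
    by rewrite ler_wpM2r ?addr_ge0//; exact: expM_le.
  have h5 : 0 <= M ^+ 4 * e by rewrite mulr_ge0 ?exprn_ge0.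
  have h6 : 0 <= M ^+ 4 * e ^+ 2 by rewrite mulr_ge0 ?exprn_ge0.
  lra.
- rewrite /ghat_td0 -scalerBl -opprD -mulrBl -mulrBl normvZ normrN !normrM.
  apply: (@le_trans _ _ (e * M * (4 * M ^+ 2) * (2 * M))).
    have h1 : normv (phi s + zeta) <= 2 * M.
      by apply: (le_trans (normvD _ _)); have := phi_M s; have := zeta_M; lra.
    rewrite ler_pM ?normv_ge0 ?mulr_ge0// ler_pM ?mulr_ge0 ?norm_td_le//.
    by rewrite ler_pM ?mulr_ge0// -normrM ratio_M.
  have h4 : 12 * M ^+ 4 * (e + e ^+ 2) <= 12 * M ^+ 5 * (e + e ^+ 2).
    by rewrite ler_wpM2r ?addr_ge0//; exact: expM_le.
  have h5 : 0 <= M ^+ 4 * e by rewrite mulr_ge0 ?exprn_ge0.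
  have h6 : 0 <= M ^+ 4 * e ^+ 2 by rewrite mulr_ge0 ?exprn_ge0.
  lra.
Qed.

Hypothesis Hstar : normv thetastar <= M.

Lemma norm_Qdir_le al th s : normv th <= M -> `|Qdir al th s| <= 36 * M ^+ 5.
Proof.
move=> thM; have M0' := M0; rewrite /Qdir normrM.
have xM : normv (th - thetastar) <= 2 * M.
  by apply: (le_trans (normvB _ _)); have := Hstar; lra.
apply: (@le_trans _ _ ((3 * M * (2 * M)) * (3 * M ^+ 2 * (2 * M)))).
  apply: ler_pM => //; apply: (le_trans (cauchy_schwarz _ _));
    by rewrite ler_pM ?normv_ge0 ?normv_td_dir ?normv_mean_dir.
by rewrite le_eqVlt; apply/orP; left; apply/eqP; ring.
Qed.

(** A product of two linear forms is Lipschitz on a bounded set; each of the two terms of the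
    difference contributes [18 * M ^+ 4]. *)
Lemma Qdir_lipschitz al th th' s : normv th <= M -> normv th' <= M ->
  `|Qdir al th s - Qdir al th' s| <= 36 * M ^+ 5 * normv (th - th').
Proof.
move=> thM thM'; have M0' := M0.
set t := td_dir s; set v := mean_dir al s; set x := th - thetastar; set x' := th' - thetastar.
have xM : normv x <= 2 * M.
  by apply: (le_trans (normvB _ _)); have := Hstar; lra.
have xM' : normv x' <= 2 * M.
  by apply: (le_trans (normvB _ _)); have := Hstar; lra.
have -> : th - th' = x - x' by rewrite /x /x' opprB addrA subrK.
rewrite (_ : _ - _ = dotv t (x - x') * dotv v x + dotv t x' * dotv v (x - x')); last first.
  by rewrite /Qdir -/t -/v -/x -/x' (dotvBr t x) (dotvBr v x); ring.
have D0 := normv_ge0 (x - x').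
apply: (le_trans (ler_normD _ _)); rewrite !normrM.
have h1 : `|dotv t (x - x')| <= 3 * M * normv (x - x').
  by apply: (le_trans (cauchy_schwarz _ _)); rewrite ler_wpM2r// normv_td_dir.
have h2 : `|dotv v (x - x')| <= 3 * M ^+ 2 * normv (x - x').
  by apply: (le_trans (cauchy_schwarz _ _)); rewrite ler_wpM2r// normv_mean_dir.
have h3 : `|dotv v x| <= 3 * M ^+ 2 * (2 * M).
  by apply: (le_trans (cauchy_schwarz _ _)); rewrite ler_pM ?normv_ge0 ?normv_mean_dir.
have h4 : `|dotv t x'| <= 3 * M * (2 * M).
  by apply: (le_trans (cauchy_schwarz _ _)); rewrite ler_pM ?normv_ge0 ?normv_td_dir.
have h5 := ler_pM (normr_ge0 _) (normr_ge0 _) h1 h3.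
have h6 := ler_pM (normr_ge0 _) (normr_ge0 _) h4 h2.
have h7 : 36 * M ^+ 4 * normv (x - x') <= 36 * M ^+ 5 * normv (x - x').
  by rewrite ler_wpM2r//; exact: expM_le.
lra.
Qed.

End UpdateDirections.

(** * Convergence rates *)

Section Rates.
Context {R : realType} {S A W : finType} {d : nat}.
Variables (P : S -> A -> S -> R) (Pr : S -> A -> W -> R) (rv : W -> R)
  (gamma : R) (pi b : S -> A -> R) (mu : S -> R)
  (phi : S -> 'rV[R]_d) (zeta : 'rV[R]_d).
Hypothesis HP : forall s a, is_distr (P s a).
Hypothesis HPr : forall s a, is_distr (Pr s a).
Hypothesis Hgamma : 0 < gamma <= 1.
Hypothesis Hpi : forall s, is_distr (pi s).
Hypothesis Hb : forall s, is_distr (b s).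
Hypothesis Hmu : stationary P b mu.
Variable thetastar : 'rV[R]_d.
Hypothesis Hthetastar : forall s, delta P Pr rv gamma pi phi zeta thetastar s = 0.
Variable Cratio : R.
Hypothesis Hratio : forall s a, pi s a <= Cratio * mu s * b s a.
Variables (C : set 'rV[R]_d) (projC : 'rV[R]_d -> 'rV[R]_d).
Hypothesis HCconvex : convex_setv C.
Hypothesis HprojC : is_eucl_proj C projC.
Hypothesis HthetastarC : C thetastar.
Variable C1 : R.
Hypothesis HC1 : 0 < C1.
Hypothesis HCbounded : forall th, C th -> normv th <= C1.
Hypothesis Hirr : irreducible P b.
Context {dO : measure_display} {Omega : measurableType dO}.
Variables (Pm : probability Omega R) (nu : S -> R).
Variables (st : nat -> Omega -> S) (at_ : nat -> Omega -> A) (rt : nat -> Omega -> W).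
Hypothesis Hst_meas : forall t x, measurable [set om | st t om = x].
Hypothesis Hat_meas : forall t x, measurable [set om | at_ t om = x].
Hypothesis Hrt_meas : forall t x, measurable [set om | rt t om = x].
Hypothesis Hlaw : traj_law P Pr b Pm nu st at_ rt.
Variables (phat : nat -> Omega -> S -> S -> R) (rhat : nat -> Omega -> S -> W -> R)
  (muhat : nat -> Omega -> S -> R).
Hypothesis Hphat : forall t, data_based st at_ rt t (phat t).
Hypothesis Hrhat : forall t, data_based st at_ rt t (rhat t).
Hypothesis Hmuhat : forall t, data_based st at_ rt t (muhat t).
Variable et : nat -> Omega -> R.
Hypothesis Het_meas : forall t, measurable_fun setT (et t).
Hypothesis Het_sq : exists (K : R) (t0 : nat), forall t : nat, (t0 <= t)%N ->
  (\int[Pm]_om ((et t om) ^+ 2)%:E <= (K / t%:R)%:E)%E.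
Hypothesis Hest_p : forall t om s', `|phat t om (st t om) s' - ppi P pi (st t om) s'| <= et t om.
Hypothesis Hest_r : forall t om w, `|rhat t om (st t om) w - rpi Pr pi (st t om) w| <= et t om.
Hypothesis Hest_mu : forall t om, `|(muhat t om (st t om))^-1 - (mu (st t om))^-1| <= et t om.

Local Notation E := (Ex Pm).
Local Notation simple := (simple st at_ rt).
Local Notation past_measurable := (past_measurable st at_ rt).
Local Notation l := (loss P Pr rv gamma pi mu phi zeta).

(** The transition [z_t] ends in [st t.+1], hence the shift by one. *)
Lemma data_based_past {X : Type} t (f : Omega -> X) :
  data_based st at_ rt t f -> past_measurable t.+1 f.
Proof.
move=> fd om om' [h1 h2]; apply: fd => i it.
have [-> -> ->] := h1 i it; split=> //.
by move: it; rewrite leq_eqVlt => /predU1P[->//|it]; have [] := h1 i.+1 it.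
Qed.

Lemma ler_sum_term {T : finType} (f : T -> R) x : (forall y, 0 <= f y) -> f x <= \sum_y f y.
Proof. by move=> f0; rewrite (bigD1 x)//= lerDl sumr_ge0. Qed.

Lemma uniform_bound : exists M, [/\ 1 <= M, C1 <= M,
  [/\ forall s, normv (phi s) <= M, normv zeta <= M & forall w, `|rv w| <= M],
  forall s a, `|pi s a / b s a| <= M & forall s, `|(mu s)^-1| <= M].
Proof.
pose a1 := \sum_s normv (phi s); pose a2 := normv zeta; pose a3 := \sum_w `|rv w|.
pose a4 := \sum_s \sum_a `|pi s a / b s a|; pose a5 := \sum_s `|(mu s)^-1|.
have p1 : 0 <= a1 by apply: sumr_ge0 => s _; exact: normv_ge0.
have p2 : 0 <= a2 by exact: normv_ge0.
have p3 : 0 <= a3 by exact: sumr_ge0.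
have p4 : 0 <= a4 by apply: sumr_ge0 => s _; exact: sumr_ge0.
have p5 : 0 <= a5 by exact: sumr_ge0.
have p6 := HC1.
exists (1 + a1 + a2 + a3 + a4 + a5 + C1); split; [lra|lra| | |].
- split=> [s||w]; [|by rewrite -/a2; lra|].
    by have := ler_sum_term s (fun s => normv_ge0 (phi s)); rewrite -/a1; lra.
  by have := ler_sum_term w (fun w => normr_ge0 (rv w)); rewrite -/a3; lra.
- move=> s a; have h1 := ler_sum_term a (fun a => normr_ge0 (pi s a / b s a)).
  have h2 : \sum_a `|pi s a / b s a| <= a4.
    by apply: (ler_sum_term (f := fun s => \sum_a `|pi s a / b s a|)) => y; exact: sumr_ge0.
  lra.
- by move=> s; have := ler_sum_term s (fun s => normr_ge0 (mu s)^-1); rewrite -/a5; lra.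
Qed.

(** The [et t] of the hypotheses is an arbitrary measurable variable, not a function of the history.
    The actual error in the sum norm replaces it: it is determined by the history and dominated by a
    constant times [et t]. *)
Definition est_err t om : R :=
  \sum_w `|rhat t om (st t om) w - rpi Pr pi (st t om) w| +
  \sum_s' `|phat t om (st t om) s' - ppi P pi (st t om) s'| +
  `|(muhat t om (st t om))^-1 - (mu (st t om))^-1|.

Lemma est_err_past t : past_measurable t.+1 (est_err t).
Proof.
move=> om om' h; rewrite /est_err (data_based_past (@Hrhat t) h)
  (data_based_past (@Hphat t) h) (data_based_past (@Hmuhat t) h).
by have [-> _ _] := proj1 h t (ltnSn t).
Qed.

(** Since [et t] need not be simple, the comparison is made between extended integrals of
    nonnegative functions. The factor [N] counts the summands of [est_err]. *)
Lemma est_err_sq : exists (Ke : R) (t0 : nat), 0 <= Ke /\ forall t, (t0 <= t)%N ->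
  E (fun om => est_err t om ^+ 2) <= Ke / t%:R.
Proof.
have [K [t0 hK]] := Het_sq.
pose N : R := #|W|%:R + #|S|%:R + 1.
have N0 : 0 <= N by rewrite !addr_ge0.
exists (N ^+ 2 * `|K|), t0; split; first by rewrite mulr_ge0 ?sqr_ge0.
move=> t tt0; have s2 : simple (fun om => est_err t om ^+ 2).
  by exists t.+1 => om om' h; rewrite (est_err_past h).
rewrite -lee_fin -(EFin_Ex Pm Hst_meas Hat_meas Hrt_meas s2).
have err_le om : 0 <= est_err t om <= N * et t om.
  apply/andP; split; first by rewrite /est_err !addr_ge0 ?sumr_ge0.
  rewrite /N !mulrDl mul1r !lerD//.
    rewrite mulr_natl -sumr_const; apply: ler_sum => w _; exact: Hest_r.
  rewrite mulr_natl -sumr_const; apply: ler_sum => s' _; exact: Hest_p.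
have mt : measurable_fun setT (fun om => ((et t om) ^+ 2)%:E).
  by apply/measurable_EFinP; exact: measurable_funX.
apply: (@le_trans _ _ (\int[Pm]_om ((N ^+ 2)%:E * ((et t om) ^+ 2)%:E))%E).
  apply: ge0_le_integral => //.
  - by move=> om _; rewrite lee_fin sqr_ge0.
  - by apply/measurable_EFinP; have [n] := s2; exact: past_measurable_measurable.
  - by apply: emeasurable_funM => //; exact: measurable_cst.
  - move=> om _; have /andP[e1 e2] := err_le om.
    by rewrite -EFinM lee_fin -exprMn ler_pXn2r ?nnegrE// (le_trans e1).
rewrite ge0_integralZl//; last 2 first.
- by move=> om _; rewrite lee_fin sqr_ge0.
- by rewrite lee_fin sqr_ge0.
rewrite -mulrA (EFinM (N ^+ 2)); apply: lee_wpmul2l; first by rewrite lee_fin sqr_ge0.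
apply: (le_trans (hK t tt0)); rewrite lee_fin ler_wpM2r ?invr_ge0//.
exact: ler_norm.
Qed.

Section Algorithm.
Variables (eta : nat -> R) (th0 : 'rV[R]_d) (al : alg).
Hypothesis Hth0 : C th0.

Local Notation X := (Defs.iter rv gamma pi b phi zeta st at_ rt phat rhat muhat projC eta th0 al).
Local Notation avg := (avg_iter rv gamma pi b phi zeta st at_ rt phat rhat muhat projC eta th0 al).

Lemma ghatE t th om : ghat rv gamma pi b phi zeta st at_ rt phat rhat muhat al t th om =
  update_dir rv gamma pi b phi zeta al (rhat t om (st t om)) (phat t om (st t om))
    (muhat t om (st t om)) th (st t om) (at_ t om) (rt t om) (st t.+1 om).
Proof. by case: al. Qed.

Lemma iter_in n om : C (X n om).
Proof. by case: n => [//|n]; have [] := HprojC (X n om - eta n.+1 *: ghat rv gamma pi b phi zeta st at_ rt phat rhat muhat al n.+1 (X n om) om). Qed.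

(** The last transition used by [X n] is that of time [n], which reveals [st n.+1] but not the next
    action. *)
Lemma iter_past n : past_measurable n.+1 (X n).
Proof.
elim: n => [//|n IH] om om' h; rewrite /= !ghatE.
rewrite (IH _ _ (same_pastW (leqnSn _) h)) (data_based_past (@Hrhat n.+1) h)
  (data_based_past (@Hphat n.+1) h) (data_based_past (@Hmuhat n.+1) h).
by have [-> -> ->] := proj1 h n.+1 (ltnSn _); rewrite (proj2 h).
Qed.

Lemma avg_past T : past_measurable T (avg T).
Proof.
move=> om om' h; rewrite /avg_iter; congr (_ *: _); apply: eq_bigr => i _.
exact/iter_past/(same_pastW _ h).
Qed.

Let D n := E (fun om => sqnormv (X n om - thetastar)).
Let B n := E (fun om => \sum_s mu s * Qdir P gamma pi mu phi zeta thetastar al (X n om) s).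

Lemma algorithm_recursion : (forall t, (0 < t)%N -> 0 <= eta t) ->
  exists (K : R) (N0 : nat) (u : nat -> R),
  [/\ 0 < K, forall n, `|u n| <= K, forall n, 0 <= D n <= K, forall n, B n <= K &
   forall n kappa, (N0 <= n)%N -> 0 < kappa ->
    D n.+1 <= D n - 2 * eta n.+1 * (B n + u n - u n.+1)
      + K * eta n.+1 * (kappa / n.+1%:R + D n / kappa + n.+1%:R^-1)
      + K * eta n.+1 ^+ 2].
Proof.
move=> eta0; have [M [M1 C1M [phi_M zeta_M rv_M] ratio_M muV_M]] := uniform_bound.
have [Ke [t0 [Ke0 e_sq]]] := est_err_sq.
have CM th : C th -> normv th <= M by move/HCbounded/le_trans; apply.
have M0 : 0 <= M by exact: le_trans ler01 M1.
pose g := true_dir P Pr rv gamma pi b mu phi zeta al.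
(* The direction of time [t] is evaluated at [theta_t], which is [X t.-1]; the truncation at [t = 0]
   is harmless, as the error bound holds at every point of [C]. *)
pose h t om := ghat rv gamma pi b phi zeta st at_ rt phat rhat muhat al t (X t.-1 om) om
  - g (X t.-1 om) (st t om) (at_ t om) (rt t om) (st t.+1 om).
apply: (@stochastic_recursion _ _ _ _ _ _ _ _ _ _ HP HPr Hb Hmu Hirr _ _ _ _ _ _
  Hst_meas Hat_meas Hrt_meas Hlaw C projC _ HCconvex HprojC HthetastarC
  (2 * M) (12 * M ^+ 5) (36 * M ^+ 5) Ke t0 _ g
  (Qdir P gamma pi mu phi zeta thetastar al) _ _ Ke0 _ _ _ _ X h est_err eta) => //.
- by move=> x y /CM xM /CM yM; apply: (le_trans (normvB _ _)); lra.
- by rewrite mulr_ge0 ?exprn_ge0.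
- by rewrite mulr_ge0 ?exprn_ge0.
- by move=> th s a w s' /CM thM; exact: normv_true_dir.
- by move=> th s; apply: true_dir_mean.
- by move=> th s /CM thM; apply: norm_Qdir_le => //; exact: CM.
- by move=> th th' s /CM thM /CM thM'; apply: Qdir_lipschitz => //; exact: CM.
- exact: iter_past.
- exact: iter_in.
- by move=> n om; congr (projC (_ - _ *: _)); rewrite /h [RHS]addrC subrK.
- move=> t om; rewrite /h ghatE; apply: normv_update_dir_err => //; first exact/CM/iter_in.
  + by rewrite /est_err -addrA lerDl addr_ge0 ?sumr_ge0.
  + by rewrite /est_err addrAC lerDr addr_ge0 ?sumr_ge0.
  + by rewrite /est_err lerDr addr_ge0 ?sumr_ge0.
- exact: est_err_past.
Qed.

Lemma simple_avg (k : 'rV[R]_d -> R) T : simple (fun om => k (avg T om)).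
Proof. by exists T => om om' /avg_past ->. Qed.

Lemma simple_iter (k : 'rV[R]_d -> R) n : simple (fun om => k (X n om)).
Proof. by exists n.+1 => om om' /iter_past ->. Qed.

Lemma E_avg_le (k : 'rV[R]_d -> R) T :
  (forall om, k (avg T om) <= T%:R^-1 * \sum_(n < T) k (X n om)) ->
  E (fun om => k (avg T om)) <= T%:R^-1 * \sum_(n < T) E (fun om => k (X n om)).
Proof.
move=> kle.
have sk (n : 'I_T) : simple (fun om => k (X n om)) by exact: simple_iter.
rewrite -(Ex_sum Pm Hst_meas Hat_meas Hrt_meas) // -(ExZ Pm Hst_meas Hat_meas Hrt_meas).
  apply: (Ex_le Pm Hst_meas Hat_meas Hrt_meas) => //; first exact: simple_avg.
  exact/simpleZ/simple_sum.
exact: simple_sum.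
Qed.

Lemma avg_sub T om : (0 < T)%N ->
  avg T om - thetastar = T%:R^-1 *: \sum_(n < T) (X n om - thetastar).
Proof.
move=> T0; rewrite sumrB scalerBr; congr (_ - _).
by rewrite sumr_const card_ord -(scaler_nat T thetastar) scalerA mulVf ?scale1r// pnatr_eq0 -lt0n.
Qed.

Lemma sqnormv_avg_le T om : (0 < T)%N ->
  sqnormv (avg T om - thetastar) <= T%:R^-1 * \sum_(n < T) sqnormv (X n om - thetastar).
Proof. by move=> T0; rewrite avg_sub// sqnormv_mean_le. Qed.

Let mu0 s : 0 <= mu s. Proof. by have [[]] := Hmu. Qed.

Lemma loss_star : l thetastar = 0.
Proof. by rewrite /loss big1// => s _; rewrite Hthetastar expr0n/= !mulr0. Qed.

Lemma loss_dotv th : l th =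
  2^-1 * \sum_s mu s * dotv (td_dir P gamma pi phi zeta s) (th - thetastar) ^+ 2.
Proof.
by rewrite mulr_sumr; apply: eq_bigr => s _; rewrite (delta_dotv Hthetastar) mulrCA.
Qed.

Lemma loss_avg_le T om : (0 < T)%N -> l (avg T om) <= T%:R^-1 * \sum_(n < T) l (X n om).
Proof.
move=> T0; rewrite loss_dotv avg_sub//.
under [X in _ <= _ * X]eq_bigr do rewrite loss_dotv.
rewrite -mulr_sumr [leRHS]mulrCA ler_wpM2l ?invr_ge0//.
rewrite exchange_big/= mulr_sumr; apply: ler_sum => s _.
rewrite -mulr_sumr [leRHS]mulrCA ler_wpM2l//.
rewrite dotvC dotvZl dotv_suml (le_trans (sqr_mean_le _))// le_eqVlt; apply/orP; left; apply/eqP.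
by congr (_ * _); apply: eq_bigr => n _; rewrite dotvC.
Qed.

(** Transfers a rate for the squared distance to the loss, which has no linear part at
    [thetastar]. *)
Lemma loss_le_sqnormv : exists2 K, 0 <= K & forall th, l th <= K * sqnormv (th - thetastar).
Proof.
exists (2^-1 * \sum_s mu s * normv (td_dir P gamma pi phi zeta s) ^+ 2).
  by rewrite mulr_ge0// sumr_ge0// => s _; rewrite mulr_ge0 ?sqr_ge0.
move=> th; rewrite loss_dotv -mulrA ler_wpM2l ?invr_ge0// mulr_suml; apply: ler_sum => s _.
rewrite -mulrA ler_wpM2l// -sqr_normv -exprMn -real_normK ?num_real//.
by rewrite ler_pXn2r ?nnegrE ?mulr_ge0 ?normv_ge0// cauchy_schwarz.
Qed.

Lemma sgd_sqrt_rate (eta0 : R) : al = DirectSGD \/ al = TDSGD ->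
  0 < eta0 -> (forall t, (0 < t)%N -> eta t = eta0 / Num.sqrt t%:R) ->
  exists (K : R) (T0 : nat), forall T : nat, (T0 <= T)%N ->
    (\int[Pm]_om (l (avg T om))%:E - (l thetastar)%:E
       <= (K * ln T%:R / Num.sqrt T%:R)%:E)%E.
Proof.
move=> hal eta00 etaE.
have eta_ge0 t : (0 < t)%N -> 0 <= eta t.
  by move=> t0; rewrite etaE// divr_ge0 ?sqrtr_ge0// ltW.
have [K [N0 [u [K0 uK DK BK rec]]]] := algorithm_recursion eta_ge0.
have [K' [T0 hT]] := sqrt_rate_of_recursion eta00 K0 etaE uK DK BK rec.
have El n : E (fun om => l (X n om)) = 2^-1 * B n.
  rewrite /B -(ExZ Pm Hst_meas Hat_meas Hrt_meas).
    by congr Ex; apply/funext => om; rewrite (Qdir_loss mu Hthetastar)// mulrA mulVf ?mul1r.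
  exact: (simple_iter (fun th => \sum_s mu s * Qdir P gamma pi mu phi zeta thetastar al th s)).
exists `|K'|, (maxn T0 2) => T; rewrite geq_max => /andP[TT0 T2].
have T0' : (0 < T)%N by exact: leq_trans T2.
rewrite loss_star sube0 (EFin_Ex Pm Hst_meas Hat_meas Hrt_meas (simple_avg l T)) lee_fin.
apply: (le_trans (E_avg_le (fun om => loss_avg_le om T0'))).
under eq_bigr do rewrite El.
rewrite -mulr_sumr; have := hT T TT0; set Sm := \sum_(n < T) _ => hSm.
have s0 : 0 < Num.sqrt T%:R :> R by rewrite sqrtr_gt0 ltr0n.
have -> : T%:R^-1 = (Num.sqrt T%:R)^-1 * (Num.sqrt T%:R)^-1 :> R.
  by rewrite -invfM -expr2 sqr_sqrtr.
set s := Num.sqrt _ in s0 hSm *.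
have lnT := @ln_ge_half R T T2.
apply: (@le_trans _ _ (s^-1 * (2^-1 * `|K'|))).
  rewrite -mulrA ler_wpM2l ?invr_ge0 ?(ltW s0)// mulrCA ler_wpM2l ?invr_ge0//.
  rewrite ler_pdivrMl// mulrC (le_trans hSm)// ler_wpM2r ?(ltW s0)//; exact: ler_norm.
rewrite mulrC ler_wpM2r ?invr_ge0 ?(ltW s0)// mulrC ler_wpM2l//.
Qed.

(** Cases (b) and (c) meet in the coercivity of the mean drift assumed here; strong convexity of the
    loss and contraction of [gbar_td0] are two ways to obtain it. *)
Lemma contraction_rate (c : R) : 0 < c ->
  (forall th, c * sqnormv (th - thetastar) <=
     \sum_s mu s * Qdir P gamma pi mu phi zeta thetastar al th s) ->
  c^-1 <= eta 1%N <= 2 / c ->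
  (forall t, (0 < t)%N -> eta t.+1 = expR (- (2^-1 * c * eta t)) * eta t) ->
  exists (K : R) (T0 : nat), forall T : nat, (T0 <= T)%N ->
    (\int[Pm]_om (sqnormv (avg T om - thetastar))%:E
       <= (K * (ln T%:R) ^+ 3 / T%:R)%:E)%E /\
    (\int[Pm]_om (l (avg T om))%:E - (l thetastar)%:E
       <= (K * (ln T%:R) ^+ 3 / T%:R)%:E)%E.
Proof.
move=> c0 Qc eta1 etaS.
have eta_ge0 t : (0 < t)%N -> 0 <= eta t.
  move=> t0; have /andP[+ _] := exp_step_bounds c0 eta1 etaS t0.
  by apply: le_trans; rewrite invr_ge0 mulr_ge0// ltW.
have [K [N0 [u [K0 uK DK BK rec]]]] := algorithm_recursion eta_ge0.
have cDB n : c * D n <= B n.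
  rewrite /D /B -(ExZ Pm Hst_meas Hat_meas Hrt_meas); last first.
    exact: (simple_iter (fun th => sqnormv (th - thetastar))).
  apply: (Ex_le Pm Hst_meas Hat_meas Hrt_meas) => //.
    exact: (simple_iter (fun th => c * sqnormv (th - thetastar))).
  exact: (simple_iter (fun th => \sum_s mu s * Qdir P gamma pi mu phi zeta thetastar al th s)).
have [n kappa nN kappa0|K' hK'] := inv_rate_of_recursion c0 K0 eta1 etaS uK DK (N0 := N0).
  apply: (le_trans (rec n kappa nN kappa0)); rewrite !lerD2r lerD2l lerN2.
  by rewrite ler_wpM2l ?mulr_ge0 ?eta_ge0// !lerD2r.
have [Kl Kl0 hKl] := loss_le_sqnormv.
(* The 12 is the best constant in [1 + x <= 12 x^3] for [x >= 1/2], applied to [x = ln T]; the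
   factor [1 + Kl] covers both the distance and the loss. *)
exists (12 * `|K'| * (1 + Kl)), 2 => T T2.
have T0 : (0 < T)%N by exact: leq_trans T2.
have lnT := @ln_ge_half R T T2.
have EavgD : E (fun om => sqnormv (avg T om - thetastar)) <=
    12 * `|K'| * (ln T%:R ^+ 3 / T%:R).
  apply: (le_trans (@E_avg_le (fun th => sqnormv (th - thetastar)) T _)).
    by move=> om; exact: sqnormv_avg_le.
  rewrite (_ : _ * (_ / _) = T%:R^-1 * (`|K'| * (12 * ln T%:R ^+ 3))); last by ring.
  rewrite ler_wpM2l ?invr_ge0//.
  apply: (@le_trans _ _ (`|K'| * (1 + ln T%:R))).
    case: T T2 T0 lnT => // T _ _ _.
    apply: (le_trans _ (ler_wpM2l (normr_ge0 K') (@harmonic_sum_le R T))).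
    rewrite mulr_sumr; apply: ler_sum => n _; apply: (le_trans (hK' n)).
    by rewrite ler_wpM2r ?invr_ge0// ler_norm.
  rewrite ler_wpM2l//.
  set x := ln _ in lnT *.
  have h1 : 0 <= (x - 2^-1) * x by rewrite mulr_ge0//; lra.
  have h2 : 0 <= (x - 2^-1) * x ^+ 2 by rewrite mulr_ge0 ?sqr_ge0//; lra.
  lra.
have s1 := simple_avg (fun th => sqnormv (th - thetastar)) T.
have q0 : 0 <= 12 * `|K'| * (ln T%:R ^+ 3 / T%:R).
  by rewrite !mulr_ge0 ?invr_ge0 ?exprn_ge0//; lra.
split.
  rewrite (EFin_Ex Pm Hst_meas Hat_meas Hrt_meas s1) lee_fin (le_trans EavgD)//.
  rewrite -[leRHS]mulrA [leRHS]mulrAC ler_peMr//; lra.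
rewrite loss_star sube0 (EFin_Ex Pm Hst_meas Hat_meas Hrt_meas (simple_avg l T)) lee_fin.
apply: (@le_trans _ _ (Kl * E (fun om => sqnormv (avg T om - thetastar)))).
  rewrite -(ExZ Pm Hst_meas Hat_meas Hrt_meas)//.
  apply: (Ex_le Pm Hst_meas Hat_meas Hrt_meas) => //; first exact: simple_avg.
  exact: simpleZ.
apply: (le_trans (ler_wpM2l Kl0 EavgD)).
rewrite -[leRHS]mulrA [leRHS]mulrAC mulrC ler_wpM2l//; lra.
Qed.

End Algorithm.

(* [l] is the quadratic form [2^-1 * \sum_s mu s * (dir s . (theta - thetastar))^2],
   so the midpoint instance of strong convexity already gives the growth bound. *)
Lemma loss_growth (c : R) : strongly_convex c l ->
  forall th, c * sqnormv (th - thetastar) <= 2 * l th.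
Proof.
move=> sc th; have h01 : 0 <= (2^-1 : R) <= 1 by apply/andP; split; lra.
have := sc th thetastar _ h01; rewrite loss_star.
(* With this value the midpoint inequality reads [l/4 <= l/2 - c q / 8], where [q] is the squared
   distance to [thetastar]. *)
have -> : l (2^-1 *: th + (1 - 2^-1) *: thetastar) = 4^-1 * l th.
  rewrite !loss_dotv mulrCA; congr (_ * _); rewrite mulr_sumr; apply: eq_bigr => s _.
  rewrite (_ : _ - thetastar = 2^-1 *: (th - thetastar)).
    by rewrite dotvC dotvZl dotvC exprMn; field.
  by apply/rowP => i; rewrite !mxE; field.
by set q := sqnormv _; set y := l th; lra.
Qed.

End Rates.

Theorem theorem3
  (R : realType) (S A W : finType) (d : nat)
  (P : S -> A -> S -> R) (Pr : S -> A -> W -> R) (rv : W -> R)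
  (gamma : R) (pi b : S -> A -> R) (mu : S -> R)
  (phi : S -> 'rV[R]_d) (zeta : 'rV[R]_d)
  (* the MDP, the policies, the features *)
  (HP : forall s a, is_distr (P s a))
  (HPr : forall s a, is_distr (Pr s a))
  (Hrv : injective rv)
  (Hgamma : 0 < gamma <= 1)
  (Hpi : forall s, is_distr (pi s))
  (Hb : forall s, is_distr (b s))
  (Hmu : stationary P b mu)
  (Hzeta : (gamma < 1 -> zeta = 0) /\
           (gamma = 1 -> forall s, dotv zeta (phi s) = 0))
  (thetastar : 'rV[R]_d)
  (Hthetastar : forall s, delta P Pr rv gamma pi phi zeta thetastar s = 0)
  (* pi(a|s) <= C mu^b(s) b(a|s) *)
  (Cratio : R) (HCratio : 0 < Cratio)
  (Hratio : forall s a, pi s a <= Cratio * mu s * b s a)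
  (* (B1) *)
  (C : set 'rV[R]_d) (HCclosed : closed C) (HCconvex : convex_setv C)
  (projC : 'rV[R]_d -> 'rV[R]_d) (HprojC : is_eucl_proj C projC)
  (HthetastarC : C thetastar)
  (Mt C0 C1 : R) (HMt : 0 < Mt) (HC0 : 0 < C0) (HC1 : 0 < C1)
  (Hrew : forall s a w, 0 < Pr s a w -> `|rv w| < Mt)
  (Hzeta0 : supnormv zeta <= C0)
  (Hphi0 : forall s, supnormv (phi s) <= C0)
  (HCbounded : forall th, C th -> normv th <= C1)
  (* (B2) *)
  (Hirr : irreducible P b)
  (Hmix : exists tau : nat, mixing_time P b mu tau)
  (* the data z_t = (st t, at_ t, rv (rt t), st t.+1) generated under b *)
  (dO : measure_display) (Omega : measurableType dO) (Pm : probability Omega R)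
  (nu : S -> R) (Hnu : is_distr nu)
  (st : nat -> Omega -> S) (at_ : nat -> Omega -> A) (rt : nat -> Omega -> W)
  (Hst_meas : forall t x, measurable [set om | st t om = x])
  (Hat_meas : forall t x, measurable [set om | at_ t om = x])
  (Hrt_meas : forall t x, measurable [set om | rt t om = x])
  (Hlaw : traj_law P Pr b Pm nu st at_ rt)
  (* data-based estimates of p(s'|s), p(r|s), mu^b(s) *)
  (phat : nat -> Omega -> S -> S -> R) (rhat : nat -> Omega -> S -> W -> R)
  (muhat : nat -> Omega -> S -> R)
  (Hphat : forall t, data_based st at_ rt t (phat t))
  (Hrhat : forall t, data_based st at_ rt t (rhat t))
  (Hmuhat : forall t, data_based st at_ rt t (muhat t))
  (* (B3) *)
  (et : nat -> Omega -> R)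
  (Het_meas : forall t, measurable_fun setT (et t))
  (Het_sq : exists (K : R) (t0 : nat), forall t : nat, (t0 <= t)%N ->
              (\int[Pm]_om ((et t om) ^+ 2)%:E <= (K / t%:R)%:E)%E)
  (Hest_p : forall t om s', `|phat t om (st t om) s' - ppi P pi (st t om) s'| <= et t om)
  (Hest_r : forall t om w, `|rhat t om (st t om) w - rpi Pr pi (st t om) w| <= et t om)
  (Hest_mu : forall t om, `|(muhat t om (st t om))^-1 - (mu (st t om))^-1| <= et t om) :
  let l := loss P Pr rv gamma pi mu phi zeta in
  let avg al eta th0 T om :=
      avg_iter rv gamma pi b phi zeta st at_ rt phat rhat muhat projC eta th0 al T om in
  (* (a) *)
  (forall al, al = DirectSGD \/ al = TDSGD ->
   forall (eta0 : R) (eta : nat -> R) (th0 : 'rV[R]_d),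
     0 < eta0 -> (forall t, (0 < t)%N -> eta t = eta0 / Num.sqrt t%:R) -> C th0 ->
     exists (K : R) (T0 : nat), forall T : nat, (T0 <= T)%N ->
       (\int[Pm]_om (l (avg al eta th0 T om))%:E - (l thetastar)%:E
          <= (K * ln T%:R / Num.sqrt T%:R)%:E)%E)
  /\
  (* (b) *)
  (forall c : R, 0 < c -> strongly_convex c l ->
   forall al, al = DirectSGD \/ al = TDSGD ->
   forall (eta : nat -> R) (th0 : 'rV[R]_d),
     c^-1 <= eta 1%N <= 2 / c ->
     (forall t, (0 < t)%N -> eta t.+1 = expR (- (2^-1 * c * eta t)) * eta t) ->
     C th0 ->
     exists (K : R) (T0 : nat), forall T : nat, (T0 <= T)%N ->
       (\int[Pm]_om (sqnormv (avg al eta th0 T om - thetastar))%:E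
          <= (K * (ln T%:R) ^+ 3 / T%:R)%:E)%E /\
       (\int[Pm]_om (l (avg al eta th0 T om))%:E - (l thetastar)%:E
          <= (K * (ln T%:R) ^+ 3 / T%:R)%:E)%E)
  /\
  (* (c) *)
  (forall c : R, 0 < c ->
   contraction_towards c (gbar_td0 P Pr rv gamma pi phi zeta) thetastar ->
   forall (eta : nat -> R) (th0 : 'rV[R]_d),
     c^-1 <= eta 1%N <= 2 / c ->
     (forall t, (0 < t)%N -> eta t.+1 = expR (- (2^-1 * c * eta t)) * eta t) ->
     C th0 ->
     exists (K : R) (T0 : nat), forall T : nat, (T0 <= T)%N ->
       (\int[Pm]_om (sqnormv (avg TD0 eta th0 T om - thetastar))%:E
          <= (K * (ln T%:R) ^+ 3 / T%:R)%:E)%E /\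
       (\int[Pm]_om (l (avg TD0 eta th0 T om))%:E - (l thetastar)%:E
          <= (K * (ln T%:R) ^+ 3 / T%:R)%:E)%E).
Proof.
move=> l avg; split; [|split].
- move=> al hal eta0 eta th0 eta00 etaE Cth0.
  exact: (sgd_sqrt_rate HP HPr Hgamma Hpi Hb Hmu Hthetastar Hratio HCconvex HprojC
    HthetastarC HC1 HCbounded Hirr Hst_meas Hat_meas Hrt_meas Hlaw Hphat Hrhat Hmuhat
    Het_meas Het_sq Hest_p Hest_r Hest_mu Cth0 hal eta00 etaE).
- move=> c c0 sc al hal eta th0 eta1 etaS Cth0.
  apply: (contraction_rate HP HPr Hgamma Hpi Hb Hmu Hthetastar Hratio HCconvex HprojC
    HthetastarC HC1 HCbounded Hirr Hst_meas Hat_meas Hrt_meas Hlaw Hphat Hrhat Hmuhat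
    Het_meas Het_sq Hest_p Hest_r Hest_mu Cth0 c0 _ eta1 etaS) => th.
  by rewrite (Qdir_loss mu Hthetastar)//; exact: (loss_growth Hthetastar sc).
- move=> c c0 [_ ctr] eta th0 eta1 etaS Cth0.
  apply: (contraction_rate HP HPr Hgamma Hpi Hb Hmu Hthetastar Hratio HCconvex HprojC
    HthetastarC HC1 HCbounded Hirr Hst_meas Hat_meas Hrt_meas Hlaw Hphat Hrhat Hmuhat
    Het_meas Het_sq Hest_p Hest_r Hest_mu Cth0 c0 _ eta1 etaS) => th.
  by rewrite (Qdir_td0 Hthetastar)//; exact: (stationary_gt0 HP Hb Hmu Hirr).
Qed.
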